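(* For every $(U_h,V_h)\in (Q_h(Q_T))^2$ with $(U_h,V_h)\ne(0,0)$ there exists $(\lambda_h,\chi_h)\in(\partial_tQ_h(Q_T))^2$, $(\lambda_h,\chi_h)\neq(0,0)$, such that $$\frac{\mathcal{A}((U_h,V_h),(\lambda_h,\chi_h))}{\|(U_h,V_h)\|_{\mathcal{V}_{e,h}(Q_T)}\,\|(\lambda_h,\chi_h)\|_{\mathcal{W}_{e,h}(Q_T)}}\ge\frac{1}{2\sqrt{C_\Omega^2/c_0^2+4T^2}}.$$
   Context: Setting: $\Omega\subset\mathbb{R}^d$ ($d\in\{1,2,3\}$) is a bounded Lipschitz polytopal domain, $T>0$, $Q_T=\Omega\times(0,T)$; $c\in L^\infty(\Omega)$ with $c(x)\ge c_0>0$ for a.e. $x\in\Omega$. $\nabla$ is the gradient in space. $C_\Omega>0$ is a constant in the Poincaré inequality $\|v\|_{L^2(\Omega)}\le C_\Omega\|\nabla v\|_{L^2(\Omega)}$ for all $v\in H^1_0(\Omega)$. $H^1_{0,\bullet}(0,T)=\{u\in H^1(0,T):u(0)=0\}$. Discrete spaces: $S_{h_x}(\Omega)\subset H^1_0(\Omega)$ and $S_{h_t}(0,T)\subset H^1_{0,\bullet}(0,T)$ are finite-dimensional subspaces; $Q_h(Q_T)=S_{h_x}(\Omega)\otimes S_{h_t}(0,T)$ and $\partial_tQ_h(Q_T)=S_{h_x}(\Omega)\otimes\partial_tS_{h_t}(0,T)$, where $\partial_tS_{h_t}(0,T)$ is the space of derivatives of elements of $S_{h_t}(0,T)$. Weighted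 product: $(\chi,\lambda)_{L^2_e(Q_T)}=\int_0^T(\chi(\cdot,s),\lambda(\cdot,s))_{L^2(\Omega)}e^{-s/T}\,ds$, with norm $\|\cdot\|_{L^2_e(Q_T)}$. On the discrete spaces the bilinear form is $\mathcal{A}((U,V),(\lambda,\chi))=(\partial_tV,\lambda)_{L^2_e(Q_T)}+(c^2\nabla U,\nabla\lambda)_{L^2_e(Q_T)}-(\partial_tU,\chi)_{L^2_e(Q_T)}+(V,\chi)_{L^2_e(Q_T)}$. Discrete Newton potential: $\mathcal{N}^\Omega_{h_x}:L^2(\Omega)\to S_{h_x}(\Omega)$ is defined by $(c^2\nabla\mathcal{N}^\Omega_{h_x}u,\nabla v_{h_x})_{L^2(\Omega)}=(u,v_{h_x})_{L^2(\Omega)}$ for all $v_{h_x}\in S_{h_x}(\Omega)$; it is applied pointwise in time to functions in $L^2(Q_T)$, and $\|U\|_{\mathcal{N}^\Omega_{e,h}}=\|c\nabla\mathcal{N}^\Omega_{h_x}U\|_{L^2_e(Q_T)}$. Discrete norms: $\|(U_h,V_h)\|^2_{\mathcal{V}_{e,h}(Q_T)}=\|\partial_tU_h\|^2_{L^2_e(Q_T)}+\|\partial_tV_h\|^2_{\mathcal{N}^\Omega_{e,h}}+\|c\nabla U_h\|^2_{L^2_e(Q_T)}+\|V_h\|^2_{L^2_e(Q_T)}$ and $\|(\lambda_h,\chi_h)\|^2_{\mathcal{W}_{e,h}(Q_T)}=\|\lambda_h\|^2_{L^2_e(Q_T)}+\|\chi_h\|^2_{\mathcal{N}^\Omega_{e,h}}$.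 *)

(* Defs.v *)
From HB Require Import structures.
From mathcomp Require Import all_boot all_order all_algebra.
From mathcomp Require Import all_classical all_reals all_analysis.

Set Implicit Arguments.
Unset Strict Implicit.
Unset Printing Implicit Defensive.

Import Order.TTheory GRing.Theory Num.Theory.
Import numFieldNormedType.Exports.

Local Open Scope classical_set_scope.
Local Open Scope ring_scope.

Definition rV_display : measure_display -> measure_display.
Proof. exact. Qed.

Section measurable_rV.
Context {d} {T : measurableType d} (n : nat).

Definition rV_coord (i : 'I_n) (x : 'rV[T]_n) : T := x ord0 i.

Let rV_set0 : g_sigma_preimage rV_coord set0.
Proof. exact: sigma_algebra0. Qed.

Let rV_setC A : g_sigma_preimage rV_coord A -> g_sigma_preimage rV_coord (~` A).
Proof. exact: sigma_algebraC. Qed.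

Let rV_bigcup (F : (set 'rV[T]_n)^nat) :
  (forall i, g_sigma_preimage rV_coord (F i)) ->
  g_sigma_preimage rV_coord (\bigcup_i F i).
Proof. exact: sigma_algebra_bigcup. Qed.

HB.instance Definition _ := @isMeasurable.Build (rV_display d)
  'rV[T]_n (g_sigma_preimage rV_coord) rV_set0 rV_setC rV_bigcup.

End measurable_rV.

Section lebesgue_rV.
Context {R : realType}.

Lemma measurable_rV_coord n (i : 'I_n) :
  measurable_fun [set: 'rV[R]_n] (fun x : 'rV[R]_n => x ord0 i).
Proof.
move=> _ Y mY; rewrite setTI; apply: sub_sigma_algebra => /=.
rewrite -bigcup_seq/=; exists i => /=; first by rewrite mem_index_enum.
by exists Y => //; rewrite setTI.
Qed.

Lemma measurable_fun_rVP d (T : measurableType d) n (f : T -> 'rV[R]_n) :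
  (forall i, measurable_fun setT (fun x => f x ord0 i)) ->
  measurable_fun setT f.
Proof.
move=> mf _ Y mY; rewrite setTI.
apply: (@smallest_sub _ (sigma_algebra setT)
  (\big[setU/set0]_(i < n) preimage_set_system setT (@rV_coord _ R n i) measurable)
  [set A | d.-measurable (f @^-1` A)] _ _ Y mY).
- split => [|A mA|F mF] /=; first by rewrite preimage_set0.
    by rewrite setTD preimage_setC; exact: measurableC.
  by rewrite preimage_bigcup; exact: bigcupT_measurable.
- move=> A; rewrite -bigcup_seq => -[i _ [B mB <-]] /=.
  rewrite setTI -comp_preimage -[X in measurable X]setTI; exact: mf.
Qed.

Local Notation mR := (measurableTypeR R).

Definition rV_cons n (p : mR * 'rV[R]_n) : 'rV[R]_n.+1 :=
  \row_i oapp (p.2 ord0) p.1 (unlift ord0 i).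

Definition rV_uncons n (x : 'rV[R]_n.+1) : mR * 'rV[R]_n :=
  (x ord0 ord0, \row_i x ord0 (lift ord0 i)).

Lemma rV_consK n : cancel (@rV_cons n) (@rV_uncons n).
Proof.
move=> [a v]; rewrite /rV_uncons /rV_cons /=; congr pair.
  by rewrite mxE unlift_none.
by apply/rowP => i; rewrite !mxE liftK.
Qed.

Lemma measurable_rV_cons n : measurable_fun setT (@rV_cons n).
Proof.
apply: measurable_fun_rVP => i; rewrite /rV_cons.
under eq_fun do rewrite mxE.
case: unliftP => [j _|_] /=; last exact: measurable_fst.
exact: (measurableT_comp (measurable_rV_coord j) measurable_snd).
Qed.

Lemma measurable_rV_uncons n : measurable_fun setT (@rV_uncons n).
Proof.
apply/measurable_fun_pairP; split; first exact: measurable_rV_coord.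
apply: measurable_fun_rVP => i /=.
rewrite /rV_uncons /=; under eq_fun do rewrite mxE.
exact: measurable_rV_coord.
Qed.

Section lebesgue_rV_step.
Context (n : nat) (m : {sigma_finite_measure set 'rV[R]_n -> \bar R}).

Let prod : {measure set (mR * 'rV[R]_n)%type -> \bar R} :=
  (lebesgue_measure \x m)%E.

Definition lebesgue_rV_step : set 'rV[R]_n.+1 -> \bar R :=
  pushforward prod (@rV_cons n).

Let mcons A : measurable A -> measurable (@rV_cons n @^-1` A).
Proof. by rewrite -[X in _ -> measurable X]setTI; exact: measurable_rV_cons. Qed.

Let step0 : lebesgue_rV_step set0 = 0%E.
Proof. by rewrite /lebesgue_rV_step /pushforward preimage_set0 measure0. Qed.

Let step_ge0 A : (0 <= lebesgue_rV_step A)%E.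
Proof. by rewrite /lebesgue_rV_step /pushforward measure_ge0. Qed.

Let step_sigma_additive : semi_sigma_additive lebesgue_rV_step.
Proof.
move=> F mF tF mUF; rewrite /lebesgue_rV_step /pushforward preimage_bigcup.
apply: measure_semi_sigma_additive; first by move=> i; exact: mcons.
- apply/trivIsetP => /= i j _ _ ij; rewrite -preimage_setI.
  by move/trivIsetP : tF => /(_ _ _ _ _ ij) ->//; rewrite preimage_set0.
- by rewrite -preimage_bigcup; exact: mcons.
Qed.

HB.instance Definition _ := isMeasure.Build _ _ _
  lebesgue_rV_step step0 step_ge0 step_sigma_additive.

Let step_sigma_finite : sigma_finite setT lebesgue_rV_step.
Proof.
have /sigma_finiteP[F [FT ndF Foo]] := sigma_finiteT (@lebesgue_measure R).
have /sigma_finiteP[G [GT ndG Goo]] := sigma_finiteT m.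
exists (fun k => @rV_uncons n @^-1` (F k `*` G k)).
  rewrite -preimage_bigcup (_ : \bigcup_k _ = setT) ?preimage_setT//.
  apply/seteqP; split => // -[x y] _.
  have [i _ Fx] : (\bigcup_k F k) x by rewrite -FT.
  have [j _ Gy] : (\bigcup_k G k) y by rewrite -GT.
  exists (maxn i j) => //; split => /=.
    by move: x Fx; exact/subsetPset/ndF/leq_maxl.
  by move: y Gy; exact/subsetPset/ndG/leq_maxr.
move=> k; have [mFk Fk] := Foo k; have [mGk Gk] := Goo k; split.
  rewrite -[X in measurable X]setTI.
  by apply: measurable_rV_uncons => //; exact: measurableX.
rewrite /lebesgue_rV_step /pushforward -comp_preimage.
rewrite (_ : _ \o _ = idfun); last by apply/funext => p; exact: rV_consK.
rewrite preimage_id [ltLHS]product_measure1E//.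
by rewrite lte_mul_pinfty// ge0_fin_numE.
Qed.

HB.instance Definition _ := Measure_isSigmaFinite.Build _ _ _
  lebesgue_rV_step step_sigma_finite.

End lebesgue_rV_step.

Fixpoint lebesgue_rV n : {sigma_finite_measure set 'rV[R]_n -> \bar R} :=
  match n with
  | 0 => @dirac _ 'rV[R]_0 0 R
  | n'.+1 => lebesgue_rV_step (lebesgue_rV n')
  end.

Lemma lebesgue_rV_box n (A : 'I_n -> set R) :
  (forall i, measurable (A i)) ->
  lebesgue_rV n [set x | forall i, A i (x ord0 i)] =
  (\prod_(i < n) lebesgue_measure (A i))%E.
Proof.
elim: n A => [|n IH] A mA /=.
  by rewrite big_ord0 diracE mem_set// => -[].
rewrite big_ord_recl -IH//.
rewrite /lebesgue_rV_step /pushforward /=.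
rewrite -product_measure1E//.
  congr (_ _); apply/seteqP; split => -[a v] /=.
    move=> h; split; first by have := h ord0; rewrite mxE unlift_none.
    by move=> i; have := h (lift ord0 i); rewrite mxE liftK.
  move=> [Aa Av] i; rewrite mxE; case: unliftP => [j ->|->] //=.
  exact: mA.
rewrite [X in measurable X](_ : _ = \bigcap_(i in [set: 'I_n])
  ((fun x : 'rV[R]_n => x ord0 i) @^-1` A (lift ord0 i))).
  apply: fin_bigcap_measurable => [|i _] /=; first exact: finite_finset.
  by rewrite -[X in measurable X]setTI; exact: measurable_rV_coord.
by apply/seteqP; split => x h i; [move=> _|]; exact: h.
Qed.

End lebesgue_rV.

Section domain.
Context {R : realType} {d : nat}.
Implicit Types (Om : set 'rV[R]_d).

Definition dotr (u v : 'rV[R]_d) : R := \sum_i u ord0 i * v ord0 i.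

Definition conv_hull (s : seq 'rV[R]_d) : set 'rV[R]_d :=
  [set x | exists a : 'I_(size s) -> R,
    [/\ forall i, 0 <= a i, \sum_i a i = 1 & x = \sum_i a i *: s`_i]].

Definition polytopal Om :=
  exists P : seq (seq 'rV[R]_d), closure Om = \bigcup_(s in [set` P]) conv_hull s.

(* Near each boundary point, [Om] is the strict subgraph of a Lipschitz function
   in some direction [e]: the graph function is evaluated at the projection
   [y - dotr y e *: e] of [y] on the hyperplane orthogonal to [e], so that [d - 1]
   coordinates need not be singled out. *)
Definition lipschitz_boundary Om :=
  forall x, (closure Om `\` interior Om) x ->
  exists (e : 'rV[R]_d) (g : 'rV[R]_d -> R),
    [/\ dotr e e = 1, [lipschitz g z | z in setT] &
       \forall y \near x, Om y <-> dotr y e < g (y - dotr y e *: e)].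

Definition lipschitz_polytopal_domain Om :=
  [/\ open Om, connected Om, Om !=set0 & bounded_set Om] /\
  lipschitz_boundary Om /\ polytopal Om.

End domain.

Definition L2 {R : realType} {disp} {X : measurableType disp}
    (m : {measure set X -> \bar R}) (D : set X) (f : X -> R) : Prop :=
  measurable_fun D f /\ (\int[m]_(x in D) (f x ^+ 2)%:E < +oo)%E.

Definition Linfty {R : realType} {disp} {X : measurableType disp}
    (m : {measure set X -> \bar R}) (D : set X) (f : X -> R) : Prop :=
  measurable_fun D f /\ exists M : R, {ae m, forall x, D x -> `|f x| <= M}.

Section space.
Context {R : realType} {d : nat}.
Implicit Types (Om : set 'rV[R]_d) (u v : 'rV[R]_d -> R).
Implicit Types (F G : 'rV[R]_d -> 'rV[R]_d).
Local Notation mu := (@lebesgue_rV R d).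

Definition partial (i : 'I_d) u : 'rV[R]_d -> R :=
  fun x => 'D_(delta_mx ord0 i) u x.

Definition smooth u :=
  forall s : seq 'I_d, continuous (foldr partial u s) /\
    forall i x, derivable (foldr partial u s) x (delta_mx ord0 i).

Definition test_fun Om u :=
  [/\ smooth u, compact (closure [set x | u x != 0])
     & closure [set x | u x != 0] `<=` Om].

Definition dotL2 Om u v : R := \int[mu]_(x in Om) (u x * v x).

Definition dotL2v Om F G : R := \int[mu]_(x in Om) dotr (F x) (G x).

Definition normL2 Om u : R := Num.sqrt (dotL2 Om u u).

Definition normL2v Om F : R := Num.sqrt (dotL2v Om F F).

Definition weak_gradient Om u G :=
  forall f, test_fun Om f -> forall i,
    dotL2 Om u (partial i f) = - dotL2 Om (fun x => G x ord0 i) f.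

(* An [H^1] function is handled as the pair of (a representative of) the function
   and (a representative of) its weak gradient; the latter is determined almost
   everywhere by the former. The operations are those of the product space. *)
Definition sobolev : Type := (('rV[R]_d -> R) * ('rV[R]_d -> 'rV[R]_d))%type.
HB.instance Definition _ := GRing.Lmodule.on sobolev.

Definition value (w : sobolev) := w.1.

Definition grad (w : sobolev) := w.2.

Definition H1 Om : set sobolev :=
  [set w | [/\ L2 mu Om (value w), forall i, L2 mu Om (fun x => grad w x ord0 i)
              & weak_gradient Om (value w) (grad w)]].

Definition H1_dist2 Om (w : sobolev) (f : 'rV[R]_d -> R) : \bar R :=
  (\int[mu]_(x in Om) ((value w x - f x) ^+ 2 +
     \sum_i (grad w x ord0 i - partial i f x) ^+ 2)%:E)%E.

Definition H10 Om : set sobolev :=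
  [set w | H1 Om w /\ exists f : nat -> 'rV[R]_d -> R,
     (forall n, test_fun Om (f n)) /\ H1_dist2 Om w (f n) @[n --> \oo] --> 0%E].

Definition ae_eq_sobolev Om (w z : sobolev) :=
  {ae mu, forall x, Om x -> value w x = value z x /\ grad w x = grad z x}.

End space.

Arguments sobolev : clear implicits.

Section time.
Context {R : realType} (T : R).
Local Notation mu := (@lebesgue_measure R).
Local Notation I := (`]0, T[%classic : set R).
Implicit Types (u : R -> R).

Definition test_fun_time u :=
  [/\ forall n t, derivable (derive1n n u) t 1, compact (closure [set t | u t != 0])
     & closure [set t | u t != 0] `<=` I].

Definition weak_derivative u (du : R -> R) :=
  forall f, test_fun_time f ->
    \int[mu]_(t in I) (u t * derive1 f t) = - \int[mu]_(t in I) (du t * f t).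

(* As for [sobolev]: a function paired with its weak derivative *)
Definition sobolev_time : Type := ((R -> R) * (R -> R))%type.
HB.instance Definition _ := GRing.Lmodule.on sobolev_time.

Definition H1_time : set sobolev_time :=
  [set p | [/\ L2 mu I p.1, L2 mu I p.2 & weak_derivative p.1 p.2]].

(* [u(0) = 0] refers to the continuous representative *)
Definition H10_time : set sobolev_time :=
  [set p | H1_time p /\ exists w : R -> R,
     [/\ {within `[0, T], continuous w}, w 0 = 0 &
        {ae mu, forall t, I t -> p.1 t = w t}]].

Definition ae_eq_time (p q : sobolev_time) :=
  {ae mu, forall t, I t -> p.1 t = q.1 t /\ p.2 t = q.2 t}.

End time.

Arguments sobolev_time : clear implicits.

(* [eqv] is the equality of the classes represented by elements of [E]. *)
Definition fin_dim_subspace {R : realType} {E : lmodType R}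
    (eqv : E -> E -> Prop) (S : set E) :=
  [/\ S 0, forall a u v, S u -> S v -> S (a *: u + v) &
     exists (n : nat) (b : 'I_n -> E), (forall i, S (b i)) /\
       forall u, S u -> exists a : 'I_n -> R, eqv u (\sum_i a i *: b i)].

Section space_time.
Context {R : realType} {d : nat}.
Variables (Om : set 'rV[R]_d) (T : R) (c : 'rV[R]_d -> R).
Variables (Sx : set (sobolev R d)) (St : set (sobolev_time R)).
Local Notation evol := (R -> sobolev R d).
Implicit Types (f g : R -> 'rV[R]_d -> R) (F G : R -> 'rV[R]_d -> 'rV[R]_d).

(* An element of [Q_h] is given together with its time derivative. *)
Definition Qh : set (evol * evol) :=
  [set U | exists (n : nat) (w : 'I_n -> sobolev R d) (p : 'I_n -> sobolev_time R),
    [/\ forall i, Sx (w i), forall i, St (p i),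
       U.1 = (fun t => \sum_i (p i).1 t *: w i) &
       U.2 = (fun t => \sum_i (p i).2 t *: w i)]].

Definition dQh : set evol :=
  [set L | exists (n : nat) (w : 'I_n -> sobolev R d) (q : 'I_n -> R -> R),
    [/\ forall i, Sx (w i), forall i, (snd @` St) (q i) &
       L = (fun t => \sum_i q i t *: w i)]].

Definition weighted_int (h : R -> R) : R :=
  \int[lebesgue_measure]_(t in `]0, T[) (h t * expR (- t / T)).

Definition dote f g : R := weighted_int (fun t => dotL2 Om (f t) (g t)).

Definition dotev F G : R := weighted_int (fun t => dotL2v Om (F t) (G t)).

Definition norme f : R := Num.sqrt (dote f f).

Definition normev F : R := Num.sqrt (dotev F F).

(* The Galerkin equation has exactly one solution up to almost everywhere equality;
   [newton] picks a representative, on which no norm below depends. *)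
Definition newton (u : 'rV[R]_d -> R) : sobolev R d :=
  xget 0 [set w | Sx w /\ forall v, Sx v ->
    dotL2v Om (fun x => c x ^+ 2 *: grad w x) (grad v) = dotL2 Om u (value v)].

Definition normN f : R := normev (fun t x => c x *: grad (newton (f t)) x).

Definition values (U : evol) : R -> 'rV[R]_d -> R := fun t => value (U t).

Definition gradients (U : evol) : R -> 'rV[R]_d -> 'rV[R]_d :=
  fun t => grad (U t).

Definition blfA (U V : evol * evol) (lam chi : evol) : R :=
  dote (values V.2) (values lam)
  + dotev (fun t x => c x ^+ 2 *: gradients U.1 t x) (gradients lam)
  - dote (values U.2) (values chi) + dote (values V.1) (values chi).

Definition normV (U V : evol * evol) : R :=
  Num.sqrt (norme (values U.2) ^+ 2 + normN (values V.2) ^+ 2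
    + normev (fun t x => c x *: gradients U.1 t x) ^+ 2
    + norme (values V.1) ^+ 2).

Definition normW (lam chi : evol) : R :=
  Num.sqrt (norme (values lam) ^+ 2 + normN (values chi) ^+ 2).

Definition zero_on_QT (U : evol) :=
  {ae lebesgue_measure, forall t, `]0, T[%classic t ->
     {ae lebesgue_rV d, forall x, Om x -> values U t x = 0}}.

End space_time.

(* Main.v *)
Require Import Defs.
From mathcomp Require Import all_boot all_order all_algebra.
From mathcomp Require Import all_classical all_reals all_analysis.
From mathcomp Require Import measurable_realfun ring lra.

Set Implicit Arguments.
Unset Strict Implicit.
Unset Printing Implicit Defensive.

Import Order.TTheory GRing.Theory Num.Theory.
Import numFieldNormedType.Exports.

Local Open Scope classical_set_scope.
Local Open Scope ring_scope.

(** The theorem holds because one explicit test pair does the job.  Write [m], [a] for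
    the mass form [(u, v)_{L^2}] and the stiffness form [(c^2 grad u, grad v)_{L^2}] on
    [Sx], [N] for the discrete Newton potential, so that [a (N u) v = m u v], and
    [n u v = a (N u) (N v)].  All three are symmetric, bilinear and nonnegative, and so
    are their integrals over time against [exp (- t / T)], still written [m], [a], [n]
    in what follows.  The test pair is
      [lam = 2 T dU + N dV]   and   [chi = 2 T dV - dU],
    where [dU], [dV] are the time derivatives of [U], [V].

    Coercivity.  The terms [m dV dU] and [- m dU dV] cancel, and
      [A = 2 T (a U dU + m V dV) + m dU dU + n dV dV + a U (N dV) - m V dU].
    Since [U] and [V] vanish at time 0, integration by parts against the decaying weight
    yields [2 T b(U, dU) >= b(U, U)] for every nonnegative form [b]: the boundary term at
    [T] is nonnegative, and the derivative of the weight contributes [b(U, U) / T].  The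
    two remaining terms are at least minus half the sum of the squares of their factors,
    where [a (N dV) (N dV) = n dV dV].  Hence [A >= X / 2] with [X] the square of the norm of
    the trial pair.

    Size of the test pair.  The mixed terms [4 T m dU (N dV)] and [- 4 T n dV dU] cancel
    since [n dV dU = m dU (N dV)], so the square of the norm of the test pair is
      [4 T^2 D + m (N dV) (N dV) + n dU dU],   [D = m dU dU + n dV dV <= X].
    With [K = COm^2 / c0^2], Poincare's inequality gives [m u u <= K a u u], whence the
    last two terms are at most [K D].  The quotient of [X / 2] by
    [sqrt X * sqrt ((K + 4 T^2) X)] is the constant of the theorem.

    The formula for the norm of the test pair also shows that the pair is nonzero unless
    [D = 0]; in that case the energy inequality for [b = m] and [b = n] makes [U] and [V]
    vanish almost everywhere.

    The analysis behind this algebra consists of: [weak_derivative_primitive], by which a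
    weakly differentiable function on an interval is a primitive of its weak derivative
    (it needs smooth test functions, built from [exp (- 1 / t)]);
    [Rintegral_product_rule], the product rule for such primitives, which is Fubini's
    theorem on a triangle; and [galerkin_solvable], the solvability of the Galerkin
    equation that defines [N]. *)

(** * Square-integrable and integrable real functions *)

Section almost_everywhere.
Context {dd} {X : measurableType dd} {R : realType} (m : {measure set X -> \bar R}).
Implicit Types P Q : X -> Prop.

Lemma ae_impl P Q : (forall x, P x -> Q x) ->
  {ae m, forall x, P x} -> {ae m, forall x, Q x}.
Proof. by move=> PQ; apply: filterS. Qed.

Lemma ae_and P Q : {ae m, forall x, P x} -> {ae m, forall x, Q x} ->
  {ae m, forall x, P x /\ Q x}.
Proof. by move=> hP hQ; apply: filterS2 hP hQ. Qed.

End almost_everywhere.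

Section real_integrals.
Context {dd} {X : measurableType dd} {R : realType}.
Variables (m : {measure set X -> \bar R}) (D : set X).
Hypothesis mD : measurable D.
Implicit Types f g : X -> R.

Definition Rintegrable f := m.-integrable D (EFin \o f).

Lemma Rintegrable_measurable f : Rintegrable f -> measurable_fun D f.
Proof. by move=> /integrableP[/measurable_EFinP]. Qed.

Lemma EFin_Rintegral f : Rintegrable f ->
  (\int[m]_(x in D) f x)%:E = (\int[m]_(x in D) (f x)%:E)%E.
Proof. by move=> hf; rewrite /Rintegral fineK//; exact: integrable_fin_num. Qed.

Lemma RintegrableD f g : Rintegrable f -> Rintegrable g -> Rintegrable (fun x => f x + g x).
Proof. by move=> hf hg; have := integrableD mD hf hg; exact: eq_integrable. Qed.

Lemma RintegrableZ (a : R) f : Rintegrable f -> Rintegrable (fun x => a * f x).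
Proof. by move=> hf; have := integrableZl mD a hf; exact: eq_integrable. Qed.

Lemma RintegrableN f : Rintegrable f -> Rintegrable (fun x => - f x).
Proof. by move=> hf; have := integrableN hf; exact: eq_integrable. Qed.

Lemma RintegrableB f g : Rintegrable f -> Rintegrable g -> Rintegrable (fun x => f x - g x).
Proof. by move=> hf hg; apply: RintegrableD => //; exact: RintegrableN. Qed.

Lemma Rintegrable_sum (I : Type) (r : seq I) (P : pred I) (F : I -> X -> R) :
  (forall i, P i -> Rintegrable (F i)) -> Rintegrable (fun x => \sum_(i <- r | P i) F i x).
Proof.
move=> hF; have := @integrable_sum _ _ _ m D mD I r P (fun i => EFin \o F i) hF.
by apply: eq_integrable => // x _ /=; rewrite sumEFin.
Qed.

Lemma Rintegral_sum (I : Type) (r : seq I) (P : pred I) (F : I -> X -> R) :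
  (forall i, P i -> Rintegrable (F i)) ->
  \int[m]_(x in D) (\sum_(i <- r | P i) F i x) =
  \sum_(i <- r | P i) \int[m]_(x in D) F i x.
Proof.
move=> hF; elim: r => [|i r IH].
  rewrite big_nil; under eq_Rintegral do rewrite big_nil.
  by rewrite Rintegral_cst// mul0r.
rewrite big_cons; case: ifPn => Pi; last first.
  by rewrite -IH; under eq_Rintegral do rewrite big_cons (negbTE Pi).
under eq_Rintegral do rewrite big_cons Pi.
by rewrite RintegralD// ?IH//; [exact: hF|exact: Rintegrable_sum].
Qed.

Lemma le_Rintegrable f g : measurable_fun D f -> Rintegrable g ->
  (forall x, D x -> `|f x| <= g x) -> Rintegrable f.
Proof.
move=> mf ig fg; apply: le_integrable ig => //; first exact/measurable_EFinP.
by move=> x Dx /=; rewrite lee_fin (le_trans (fg x Dx))// ler_norm.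
Qed.

Lemma Rintegrable_bounded_mul f g (M : R) : measurable_fun D g ->
  (forall x, D x -> `|g x| <= M) -> Rintegrable f -> Rintegrable (fun x => f x * g x).
Proof.
move=> mg gM hf; apply: (@le_Rintegrable _ (fun x => M * `|f x|)).
- by apply: measurable_funM => //; exact: Rintegrable_measurable.
- by apply: RintegrableZ; exact: integrable_norm.
- by move=> x Dx; rewrite normrM mulrC ler_wpM2r// gM.
Qed.

Lemma L2_Rintegrable_sqr f : L2 m D f -> Rintegrable (fun x => f x ^+ 2).
Proof.
move=> [mf lf]; apply/integrableP; split.
  by apply/measurable_EFinP; exact: measurable_funX.
apply: le_lt_trans lf; apply: ge0_le_integral => //=.
- by apply/measurable_EFinP; apply: measurableT_comp => //; exact: measurable_funX.
- by apply/measurable_EFinP; exact: measurable_funX.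
- by move=> x Dx; rewrite ger0_norm ?sqr_ge0.
Qed.

Lemma L2_Rintegrable_mul f g : L2 m D f -> L2 m D g -> Rintegrable (fun x => f x * g x).
Proof.
move=> hf hg; apply: (@le_Rintegrable _ (fun x => f x ^+ 2 + g x ^+ 2)).
- by apply: measurable_funM; [case: hf|case: hg].
- by apply: RintegrableD; exact: L2_Rintegrable_sqr.
- move=> x _; rewrite normrM.
  rewrite -(real_normK (num_real (f x))) -(real_normK (num_real (g x))).
  by have := sqr_ge0 (`|f x| - `|g x|); nra.
Qed.

Lemma ae_Rintegral f g : measurable_fun D f -> measurable_fun D g ->
  {ae m, forall x, D x -> f x = g x} ->
  \int[m]_(x in D) f x = \int[m]_(x in D) g x.
Proof.
move=> mf mg fg; congr fine; apply: ae_eq_integral => //; [exact/measurable_EFinP..|].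
by apply: filterS fg => x h Dx /=; rewrite h.
Qed.

Lemma ae_le_Rintegral f g : Rintegrable f -> Rintegrable g ->
  {ae m, forall x, D x -> f x <= g x} ->
  \int[m]_(x in D) f x <= \int[m]_(x in D) g x.
Proof.
move=> hf hg fg; rewrite -subr_ge0 -RintegralB//.
rewrite (@ae_Rintegral _ (fun x => `|g x - f x|)).
- by apply: Rintegral_ge0 => x _; exact: normr_ge0.
- exact: (Rintegrable_measurable (RintegrableB hg hf)).
- by apply: measurableT_comp => //; exact: (Rintegrable_measurable (RintegrableB hg hf)).
- by apply: ae_impl fg => x h Dx; rewrite ger0_norm// subr_ge0 h.
Qed.

Lemma L2_Linfty f g : L2 m D f -> Linfty m D g -> L2 m D (fun x => g x * f x).
Proof.
move=> [mf lf] [mg [M hM]]; split; first exact: measurable_funM.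
have hf : Rintegrable (fun x => f x ^+ 2) by exact: L2_Rintegrable_sqr.
apply: (@le_lt_trans _ _ (\int[m]_(x in D) (M ^+ 2 * f x ^+ 2)%R%:E)%E).
  apply: ae_ge0_le_integral => //.
  - by move=> x _; rewrite lee_fin sqr_ge0.
  - by apply/measurable_EFinP/measurable_funX; exact: measurable_funM.
  - by move=> x _; rewrite lee_fin mulr_ge0// sqr_ge0.
  - by apply/measurable_EFinP; exact: (Rintegrable_measurable (RintegrableZ (M ^+ 2) hf)).
  - apply: ae_impl hM => x h Dx; rewrite lee_fin exprMn ler_wpM2r ?sqr_ge0//.
    by rewrite -(real_normK (num_real (g x))) lerXn2r ?nnegrE// (le_trans _ (h Dx)).
exact: (integrable_lty mD (RintegrableZ (M ^+ 2) hf)).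
Qed.

(** Turns the vanishing of an energy into the vanishing of a function. *)
Lemma Rintegral_eq0_ae f : Rintegrable f -> (forall x, D x -> 0 <= f x) ->
  \int[m]_(x in D) f x = 0 -> {ae m, forall x, D x -> f x = 0}.
Proof.
move=> hf f0 hI; have [/measurable_EFinP mf _] := integrableP _ _ _ hf.
have /(ae_eq_integral_abs m mD) : measurable_fun D (EFin \o f) by exact/measurable_EFinP.
move=> [h _]; have : ae_eq m D (EFin \o f) (cst 0%E).
  apply: h; transitivity (\int[m]_(x in D) f x)%:E; last by rewrite hI.
  rewrite /Rintegral fineK; last exact: integrable_fin_num.
  by apply: eq_integral => x /set_mem Dx /=; rewrite ger0_norm// f0.
by apply: filterS => x + Dx => /(_ Dx) /= [].
Qed.

End real_integrals.

(** * Smooth cut-off functions on the line *)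

Section smooth_step.
Context {R : realType}.
Implicit Types (f g : R -> R) (t : R).

(** [n]-fold differentiability on the whole line, with the derivative as a witness: in
    this form the closure properties below are plain inductions. *)
Fixpoint Ck (n : nat) f : Prop :=
  if n is m.+1 then exists2 g : R -> R, (forall t, is_derive t (1 : R) f (g t)) & Ck m g
  else True.

Definition smooth1 f := forall n, Ck n f.

Lemma is_derive_derive1 f g : (forall t, is_derive t (1 : R) f (g t)) ->
  f^`()%classic = g.
Proof. by move=> fg; apply/funext => t; rewrite derive1E; exact: derive_val. Qed.

Lemma is_derive_continuous f g :
  (forall t, is_derive t (1 : R) f (g t)) -> continuous f.
Proof.
move=> fg t; apply/differentiable_continuous/derivable1_diffP.
by have [] := fg t.
Qed.

Lemma smooth1_derivable f : smooth1 f -> forall n t, derivable (derive1n n f) t 1.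
Proof.
move=> sf n; have := sf n.+1; elim: n f {sf} => [|n IH] f [g fg Cg] t.
  by have [] := fg t.
by rewrite derive1Sn (is_derive_derive1 fg); exact: IH.
Qed.

Lemma CkS n f : Ck n.+1 f -> Ck n f.
Proof. by elim: n f => // n IH f [g fg] /IH; exists g. Qed.

Lemma Ck_cst n (a : R) : Ck n (fun=> a).
Proof.
elim: n a => // n IH a; exists (fun=> 0) => // t.
exact: is_derive_cst.
Qed.

Lemma CkD n f g : Ck n f -> Ck n g -> Ck n (fun t => f t + g t).
Proof.
elim: n f g => // n IH f g [f' ff' Cf'] [g' gg' Cg'].
exists (fun t => f' t + g' t); last exact: IH.
by move=> t; apply: (@is_deriveD _ _ _ f g).
Qed.

Lemma CkM n f g : Ck n f -> Ck n g -> Ck n (fun t => f t * g t).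
Proof.
elim: n f g => // n IH f g Cf Cg.
case: (Cf) => f' ff' Cf'; case: (Cg) => g' gg' Cg'.
exists (fun t => f t * g' t + g t * f' t).
  by move=> t; apply: (@is_deriveM _ _ f g).
by apply: CkD; apply: IH => //; exact: CkS.
Qed.

Lemma CkV n f : (forall t, f t != 0) -> Ck n f -> Ck n (fun t => (f t)^-1).
Proof.
move=> f0; elim: n => // n IH Cf; case: (Cf) => f' ff' Cf'.
have CV := IH (CkS Cf).
exists (fun t => - 1 * ((f t)^-1 * (f t)^-1) * f' t).
  move=> t; apply: is_derive_eq.
  by rewrite /GRing.scale /= mulN1r -invrM ?unitfE// -expr2.
by apply: CkM => //; apply: CkM; [exact: Ck_cst|exact: CkM].
Qed.

Lemma is_derive_affine f g (k b t : R) : (forall t, is_derive t (1 : R) f (g t)) ->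
  is_derive t (1 : R) (fun t => f (k * t + b)) (k * g (k * t + b)).
Proof.
move=> fg; have h : is_derive t (1 : R) (fun t => k * t + b) k.
  have -> : (fun t => k * t + b) = (k *: id + cst b) by [].
  by apply: is_derive_eq; rewrite /GRing.scale /= mulr1 addr0.
have := @is_derive1_comp _ f (fun t => k * t + b) t (g (k * t + b)) k (fg _) h.
by rewrite mulrC.
Qed.

Lemma Ck_affine n f (k b : R) : Ck n f -> Ck n (fun t => f (k * t + b)).
Proof.
elim: n f => // n IH f [g fg Cg].
exists (fun t => k * g (k * t + b)); first by move=> t; exact: is_derive_affine.
by apply: (@CkM _ (fun=> k)); [exact: Ck_cst|exact: IH].
Qed.

(** The case [P = 1] is the classical function [exp (- 1 / t)].  The polynomial factor
    in [1 / t] makes the family stable under differentiation. *)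
Definition flat (P : {poly R}) t : R :=
  if 0 < t then P.[t^-1] * expR (- t^-1) else 0.

Lemma flat0 P t : t <= 0 -> flat P t = 0.
Proof. by rewrite /flat ltNge => ->. Qed.


(** The exponential dominates each term of its series. *)
Lemma exprn_expRN_le n (x : R) : 0 <= x -> x ^+ n * expR (- x) <= n`!%:R.
Proof.
move=> x0; rewrite expRN ler_pdivrMr ?expR_gt0//.
case: n => [|n]; first by rewrite expr0 fact0 mul1r -[leLHS]expR0 ler_expR.
have n0 : (0 : R) < n.+1`!%:R by rewrite ltr0n fact_gt0.
rewrite mulrC -ler_pdivrMr//; apply: le_trans (expR_ge1Dxn n x0).
by rewrite lerDr.
Qed.

Lemma horner_expRN_bounded (P : {poly R}) :
  exists2 C : R, 0 <= C & forall x, 0 <= x -> `|P.[x] * expR (- x)| <= C.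
Proof.
exists (\sum_(i < size P) `|P`_i| * i`!%:R).
  by apply: sumr_ge0 => i _; rewrite mulr_ge0.
move=> x x0; rewrite horner_coef mulr_suml; apply: le_trans (ler_norm_sum _ _ _) _.
apply: ler_sum => i _; rewrite -mulrA normrM ler_wpM2l//.
by rewrite ger0_norm ?exprn_expRN_le// mulr_ge0 ?exprn_ge0// expR_ge0.
Qed.

(** Quadratic decay at 0 is what makes the difference quotient there tend to 0. *)
Lemma flat_sqr_bounded (P : {poly R}) :
  exists2 C : R, 0 <= C & forall t, `|flat P t| <= C * t ^+ 2.
Proof.
have [C C0 hC] := horner_expRN_bounded (P * 'X^2); exists C => // t.
have [t0|t0] := lerP t 0; first by rewrite flat0// normr0 mulr_ge0// sqr_ge0.
have := hC t^-1; rewrite invr_ge0 (ltW t0) hornerM hornerXn => /(_ isT).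
rewrite /flat t0 -ler_pdivrMr ?exprn_gt0// -[X in _ -> _ * X <= _]ger0_norm.
  by rewrite -normrM mulrAC exprVn.
by rewrite invr_ge0 exprn_ge0// ltW.
Qed.

Lemma is_derive_flat (P : {poly R}) t :
  is_derive t (1 : R) (flat P) (flat ('X^2 * (P - P^`())) t).
Proof.
have [t0|t0|->] := ltrgtP t 0.
- rewrite [X in is_derive _ _ _ X]flat0 ?ltW//; apply: (@near_eq_is_derive _ _ _ (fun=> 0)).
    near=> s; rewrite flat0//; apply: ltW; near: s; exact: lt_nbhsl.
- have t00 : t != 0 by rewrite gt_eqF.
  have dV : is_derive t (1 : R) (fun s => s^-1) (- t ^- 2 *: 1).
    exact: (is_deriveV t00 (is_derive_id t (1 : R))).
  have dP : is_derive t (1 : R) (fun s => P.[s^-1]) (P^`().[t^-1] * (- t ^- 2 *: 1)).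
    exact: (is_derive1_comp (is_derive_poly P t^-1) dV).
  have dE : is_derive t (1 : R) (fun s => expR (- s^-1))
      (expR (- t^-1) * - (- t ^- 2 *: 1)).
    exact: (@is_derive1_comp _ expR (fun s => - s^-1) t _ _ (is_derive_expR _) (is_deriveN dV)).
  have dPE := is_deriveM dP dE.
  have e : \forall s \near t, P.[s^-1] * expR (- s^-1) = flat P s.
    by near=> s; rewrite /flat ifT//; near: s; exact: lt_nbhsr.
  have := near_eq_is_derive e dPE => dflat; apply: is_derive_eq.
  rewrite /flat t0 hornerM hornerXn hornerD hornerN exprVn /GRing.scale /=; ring.
- rewrite [X in is_derive _ _ _ X]flat0//; have [C C0 hC] := flat_sqr_bounded P.
  suff h : h^-1 *: ((flat P \o shift 0) (h *: (1 : R)) - flat P 0) @[h --> 0^'] --> (0 : R).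
    by apply: DeriveDef; [apply/cvg_ex; exists 0|exact: cvg_lim h].
  apply/cvgrPdist_le => /= e e0; near=> h.
  rewrite sub0r normrN addr0 [flat P 0]flat0// subr0 normrM normfV.
  have h0 : 0 < `|h| by rewrite normr_gt0; near: h; exact: nbhs_dnbhs_neq.
  rewrite mulrC ler_pdivrMr// /GRing.scale /= mulr1; apply: le_trans (hC _) _.
  have -> : C * h ^+ 2 = C * `|h| * `|h| by rewrite -mulrA -expr2 real_normK ?num_real.
  rewrite ler_pM2r//; apply: (@le_trans _ _ ((C + 1) * `|h|)).
    by rewrite ler_wpM2r// lerDl.
  rewrite mulrC -ler_pdivlMr ?ltr_wpDl//.
  near: h; apply: dnbhs0_le.
  by rewrite divr_gt0// ltr_wpDl.
Unshelve. all: by end_near. Qed.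

(** Every derivative of a member of the family is again a member. *)
Lemma smooth1_flat P : smooth1 (flat P).
Proof.
move=> n; elim: n P => // n IH P; exists (flat ('X^2 * (P - P^`()))) => //.
exact: is_derive_flat.
Qed.

Lemma flat1_gt0 t : 0 < t -> 0 < flat 1 t.
Proof. by move=> t0; rewrite /flat t0 hornerE mul1r expR_gt0. Qed.

Lemma flat1_ge0 t : 0 <= flat 1 t.
Proof. by have [t0|/flat1_gt0/ltW//] := lerP t 0; rewrite flat0. Qed.

Let den t := flat 1 t + flat 1 (-1 * t + 1).

Let den_gt0 t : 0 < den t.
Proof.
rewrite /den; have [t0|t0] := lerP t 0.
  by rewrite ltr_wpDl ?flat1_ge0// flat1_gt0//; lra.
by rewrite ltr_pwDl ?flat1_ge0// flat1_gt0.
Qed.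

Definition step t := flat 1 t * (den t)^-1.

Lemma smooth1_step : smooth1 step.
Proof.
move=> n; apply: CkM; first exact: smooth1_flat.
apply: CkV; first by move=> t; rewrite gt_eqF.
by apply: CkD; [|apply: Ck_affine]; exact: smooth1_flat.
Qed.

Lemma step_le0 t : t <= 0 -> step t = 0.
Proof. by move=> t0; rewrite /step flat0// mul0r. Qed.

Lemma step_ge1 t : 1 <= t -> step t = 1.
Proof.
move=> t1; rewrite /step /den (@flat0 _ (_ + _)) ?addr0 ?divff ?gt_eqF ?flat1_gt0//; lra.
Qed.

Lemma step_ge0 t : 0 <= step t.
Proof. by rewrite mulr_ge0 ?flat1_ge0// invr_ge0 ltW. Qed.

Lemma step_le1 t : step t <= 1.
Proof. by rewrite ler_pdivrMr// mul1r lerDl flat1_ge0. Qed.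

(** The derivative of [step] acts as a nonnegative averaging kernel supported in
    [[0, 1]]. *)
Lemma step_derive : exists g, [/\ forall t, is_derive t (1 : R) step (g t),
  continuous g, forall t, 0 <= g t & forall t, t < 0 \/ 1 < t -> g t = 0].
Proof.
have [g sg Cg] := smooth1_step 2; exists g; split => //.
- by have [h gh _] := Cg; exact: is_derive_continuous gh.
- move=> t; pose d t := flat ('X^2 * (1 - 1^`())) t.
  have fd s : is_derive s (1 : R) (flat 1) (d s) by exact: is_derive_flat.
  have d0 s : 0 <= d s.
    rewrite /d; have [s0|s0] := lerP s 0; first by rewrite flat0.
    rewrite /flat s0 mulr_ge0 ?expR_ge0// derivC subr0 mulr1 hornerXn.
    by rewrite exprn_ge0// invr_ge0 ltW.
  have dd : is_derive t (1 : R) den (d t + -1 * d (-1 * t + 1)).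
    by apply: is_deriveD => //; exact: is_derive_affine.
  have dV : is_derive t (1 : R) (fun t => (den t)^-1)
      (- (den t) ^- 2 *: (d t + -1 * d (-1 * t + 1))).
    by apply: is_deriveV => //; rewrite gt_eqF.
  have := @is_deriveM _ _ _ _ _ _ _ _ (fd t) dV.
  move=> [_]; have [_ ->] := sg t => ->.
  rewrite /GRing.scale /=.
  rewrite [leRHS](_ : _ = (den t)^-2 * (flat 1 t * d (-1 * t + 1) + flat 1 (-1 * t + 1) * d t)).
    rewrite mulr_ge0 ?invr_ge0 ?sqr_ge0// addr_ge0// mulr_ge0// flat1_ge0//.
  have := den_gt0 t; rewrite /den => D; field; lra.
- move=> t [t0|t1].
    have [_ <-] := sg t; rewrite (@near_eq_derive _ _ _ _ (fun=> 0)) ?derive_cst//.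
    near=> s; rewrite step_le0//; apply: ltW; near: s; exact: lt_nbhsl.
  have [_ <-] := sg t; rewrite (@near_eq_derive _ _ _ _ (fun=> 1 : R)) ?derive_cst//.
  near=> s; rewrite step_ge1//; apply: ltW; near: s; exact: lt_nbhsr.
Unshelve. all: by end_near. Qed.

End smooth_step.

(** * Weakly differentiable functions are primitives *)

Section du_bois_reymond.
Context {R : realType}.
Notation mu := (@lebesgue_measure R).
Implicit Types (f g u w : R -> R) (a b t : R).

Lemma Rintegrable_within_continuous f a b : {within `[a, b], continuous f} ->
  Rintegrable mu `]a, b[ f.
Proof.
move=> cf; apply: (@integrableS _ _ _ mu `[a, b]) => //.
  exact: subset_itv_oo_cc.
by apply: continuous_compact_integrable => //; exact: segment_compact.
Qed.

Lemma Rintegral_oo_derive f g a b : a < b ->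
  (forall t, is_derive t (1 : R) f (g t)) -> continuous g ->
  \int[mu]_(t in `]a, b[) g t = f b - f a.
Proof.
move=> ab fg cg; have cf := is_derive_continuous fg.
have ig : mu.-integrable `[a, b] (EFin \o g).
  apply: continuous_compact_integrable; first exact: segment_compact.
  exact: continuous_subspaceT.
rewrite Rintegral_itv_bndo_bndc; last first.
  by apply: integrableS ig => //; exact: subset_itv_oo_cc.
rewrite Rintegral_itv_obnd_cbnd; last first.
  by apply: integrableS ig => //; exact: subset_itv_oc_cc.
rewrite /Rintegral (continuous_FTC2 (F := f) ab)//.
- exact: continuous_subspaceT.
- split; [by move=> t _; case: (fg t)| |].
    by apply: cvg_at_right_filter; exact: cf.
  by apply: cvg_at_left_filter; exact: cf.
- by move=> t _; rewrite (is_derive_derive1 fg).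
Qed.

(** The rescaled kernel has mass 1 and lives on [[l, l + 1 / K]], so integrating against
    it is averaging over that interval. *)
Lemma step_average g w (T K l wl e : R) :
  (forall t, is_derive t (1 : R) step (g t)) -> continuous g ->
  (forall t, 0 <= g t) -> (forall t, t < 0 \/ 1 < t -> g t = 0) ->
  0 < T -> 0 < K -> 0 <= l -> l + K^-1 <= T ->
  {within `[0, T], continuous w} ->
  (forall t, l <= t <= l + K^-1 -> 0 < t < T -> `|w t - wl| <= e) ->
  `|\int[mu]_(t in `]0, T[) (w t * (K * g (K * t + - (K * l)))) - wl| <= e.
Proof.
move=> sg cg g0 gout T0 K0 l0 lT cw we.
set G := fun t => K * g (K * t + - (K * l)).
have cG : continuous G.
  move=> t; apply: cvgM; first exact: cvg_cst.
  apply: (@continuous_comp _ _ _ (fun t => K * t + - (K * l)) g); last exact: cg.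
  by apply: cvgD; [apply: cvgM; [exact: cvg_cst|exact: cvg_id]|exact: cvg_cst].
have dG t : is_derive t (1 : R) (fun t => step (K * t + - (K * l))) (G t).
  exact: is_derive_affine.
have G0 t : 0 <= G t by rewrite mulr_ge0// ltW.
have IG : \int[mu]_(t in `]0, T[) G t = 1.
  rewrite (Rintegral_oo_derive T0 dG cG) step_ge1; last first.
    rewrite -mulrBr -(ler_pM2l (_ : 0 < K^-1)) ?invr_gt0//.
    by rewrite mulr1 mulKf ?gt_eqF// lerBrDl.
  by rewrite mulr0 add0r step_le0 ?subr0// oppr_le0 mulr_ge0// ltW.
have iG : Rintegrable mu `]0, T[ G.
  by apply: Rintegrable_within_continuous; exact: continuous_subspaceT.
have iwG : Rintegrable mu `]0, T[ (fun t => w t * G t).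
  apply: Rintegrable_within_continuous => t.
  by apply: cvgM; [exact: cw|exact: (continuous_subspaceT cG)].
have -> : wl = \int[mu]_(t in `]0, T[) (wl * G t) by rewrite RintegralZl// IG mulr1.
rewrite -RintegralB//; last exact: RintegrableZ.
have iB : Rintegrable mu `]0, T[ (fun t => w t * G t - wl * G t).
  by apply: RintegrableB => //; exact: RintegrableZ.
apply: (le_trans (le_normr_Rintegral _ _)) => //.
apply: (@le_trans _ _ (\int[mu]_(t in `]0, T[) (e * G t))); last first.
  by rewrite RintegralZl// IG mulr1.
apply: le_Rintegral => //; [exact: integrable_norm|exact: RintegrableZ|].
move=> t /=; rewrite in_itv /= => tT.
rewrite -mulrBl normrM (ger0_norm (G0 t)).
have [/andP[h1 h2]|h] := boolP (l <= t <= l + K^-1).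
  by rewrite ler_wpM2r// we// h1 h2.
suff -> : G t = 0 by rewrite !mulr0.
rewrite /G gout ?mulr0//; move: h; rewrite negb_and -!ltNge => /orP[h|h]; [left|right].
  by rewrite -mulrBr pmulr_rlt0// subr_lt0.
rewrite -mulrBr -(ltr_pM2l (_ : 0 < K^-1)) ?invr_gt0//.
by rewrite mulr1 mulKf ?gt_eqF// ltrBrDl.
Qed.


Lemma within_continuous_modulus w (T x e : R) : {within `[0, T], continuous w} ->
  0 <= x <= T -> 0 < e ->
  exists2 de : R, 0 < de & forall t, 0 < t < T -> `|t - x| < de -> `|w t - w x| <= e.
Proof.
move=> /subspace_continuousP cw x0T e0; have := cw x.
rewrite /= in_itv /= => /(_ x0T) /cvgrPdist_le /(_ e e0).
rewrite near_withinE => /nbhs_ballP[de /= de0 h]; exists de => // t /andP[t0 tT] td.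
rewrite distrC; apply: h; first by rewrite /ball /= distrC.
by rewrite /= in_itv /= !ltW.
Qed.

Lemma step_average_cvg g w (T x : R) (l : nat -> R) :
  (forall t, is_derive t (1 : R) step (g t)) -> continuous g ->
  (forall t, 0 <= g t) -> (forall t, t < 0 \/ 1 < t -> g t = 0) ->
  0 <= x < T -> (forall k, x <= l k <= x + k.+1%:R^-1) ->
  {within `[0, T], continuous w} ->
  \int[mu]_(t in `]0, T[) (w t * (k.+1%:R * g (k.+1%:R * t + - (k.+1%:R * l k))))
    @[k --> \oo] --> w x.
Proof.
move=> sg cg g0 gout /andP[x0 xT] xl cw; apply/cvgrPdist_le => /= e e0.
have xT' : 0 <= x <= T by rewrite x0 ltW.
have [de de0 wd] := within_continuous_modulus cw xT' e0.
have hd : 0 < de / 3 by rewrite divr_gt0.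
have hT : 0 < (T - x) / 2 by rewrite divr_gt0// subr_gt0.
near=> k; rewrite distrC.
have k0 : (0 : R) < k.+1%:R by rewrite ltr0n.
have kd : k.+1%:R^-1 < de / 3 by near: k; exact: (near_infty_natSinv_lt (PosNum hd)).
have kT : k.+1%:R^-1 < (T - x) / 2.
  by near: k; exact: (near_infty_natSinv_lt (PosNum hT)).
have k1 : (0 : R) < k.+1%:R^-1 by rewrite invr_gt0.
have /andP[l1 l2] := xl k.
move: (k.+1%:R : R) k0 kd kT k1 l2 => K K0 Kd KT.
move: (l k) l1 => lk l1 K1 l2.
apply: (step_average sg) => //; [lra|lra|lra|].
move: (K^-1) Kd KT K1 l2 => Ki Kd KT K1 l2 t /andP[t1 t2] t0T.
apply: wd => //; rewrite ger0_norm; lra.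
Unshelve. all: by end_near. Qed.

(** The lemma of du Bois-Reymond.  The test functions are smoothed indicators of
    [[0, b]]: they rise on [[1 / K, 2 / K]] and fall on [[b, b + 1 / K]].  As [K] grows, the
    integral of [w] against their derivative tends to [w 0 - w b], while dominated
    convergence sends the integral of [du] against them to its integral on [[0, b]]. *)
Lemma weak_derivative_primitive (T : R) u du w b : 0 < T ->
  measurable_fun `]0, T[ u -> Rintegrable mu `]0, T[ du -> weak_derivative T u du ->
  {within `[0, T], continuous w} -> w 0 = 0 ->
  {ae mu, forall t, `]0, T[%classic t -> u t = w t} ->
  0 < b < T -> w b = \int[mu]_(t in `]0, b]) du t.
Proof.
move=> T0 mu_ idu wd cw w0 uw /andP[b0 bT].
have [g [sg cg g0 gout]] := @step_derive R.
pose K (k : nat) : R := k.+1%:R.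
have K0 k : 0 < K k by rewrite ltr0n.
have KV0 k : 0 < (K k)^-1 by rewrite invr_gt0.
pose G (l : nat -> R) k t := K k * g (K k * t + - (K k * l k)).
pose S (l : nat -> R) k t := step (K k * t + - (K k * l k)).
pose l1 k := (K k)^-1; pose l2 (k : nat) := b.
have A : \int[mu]_(t in `]0, T[) (w t * G l1 k t) @[k --> \oo] --> w 0.
  apply: (step_average_cvg sg) => //; first by rewrite lexx.
  by move=> k; rewrite /l1 add0r lexx ltW.
have B : \int[mu]_(t in `]0, T[) (w t * G l2 k t) @[k --> \oo] --> w b.
  apply: (step_average_cvg sg) => //; first by rewrite ltW.
  by move=> k; rewrite /l2 lexx lerDl ltW.
have dS l k t : is_derive t (1 : R) (S l k) (G l k t) by exact: is_derive_affine.
pose F k t := S l1 k t + -1 * S l2 k t.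
have dF k t : is_derive t (1 : R) (F k) (G l1 k t + -1 * G l2 k t).
  by apply: is_deriveD.
have sF k n : Ck n (F k).
  apply: CkD; first by apply: Ck_affine; exact: smooth1_step.
  apply: (@CkM _ _ (fun=> -1)); first exact: Ck_cst.
  by apply: Ck_affine; exact: smooth1_step.
have cS l k : continuous (S l k) by exact: is_derive_continuous (dS l k).
have cF k : continuous (F k) by exact: is_derive_continuous (dF k).
have cG l k : continuous (G l k).
  move=> t; apply: cvgM; first exact: cvg_cst.
  apply: (@continuous_comp _ _ _ (fun t => K k * t + - (K k * l k)) g); last exact: cg.
  by apply: cvgD; [apply: cvgM; [exact: cvg_cst|exact: cvg_id]|exact: cvg_cst].
have S0 l k t : t <= l k -> S l k t = 0.
  by move=> tl; rewrite /S step_le0// -mulrBr pmulr_rle0// subr_le0.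
have S1 l k t : l k + (K k)^-1 <= t -> S l k t = 1.
  move=> tl; rewrite /S step_ge1// -mulrBr -(ler_pM2l (KV0 k)).
  by rewrite mulr1 mulKf ?gt_eqF// lerBrDl.
have FE k : (K k)^-1 < b -> (K k)^-1 < T - b ->
    \int[mu]_(t in `]0, T[) (w t * G l1 k t) -
    \int[mu]_(t in `]0, T[) (w t * G l2 k t) =
    - \int[mu]_(t in `]0, T[) (du t * F k t).
  move=> kb kT; rewrite -wd; last first.
    (* On the left of this interval both steps are 0, on its right both are 1. *)
have Fsub : closure [set t | F k t != 0] `<=` `[(K k)^-1, b + (K k)^-1]%classic.
      rewrite [X in _ `<=` X](iffLR (closure_id _)); last exact: interval_closed.
      apply: closure_subset => t /= Ft; rewrite in_itv /= !leNgt.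
      apply/andP; split; apply: contra Ft => h; rewrite /F.
        by rewrite !S0 ?mulr0 ?addr0// ltW// (lt_trans h).
      rewrite !S1 ?mulr1 ?subrr// ltW//; apply: le_lt_trans h.
      by rewrite /l1 lerD2r ltW.
    split; first exact: smooth1_derivable.
      by apply: (subclosed_compact _ (@segment_compact _ _ _)) Fsub; exact: closed_closure.
    move=> t /Fsub /=; rewrite !in_itv /= => /andP[t1 t2].
    by rewrite (lt_le_trans (KV0 k))//= (le_lt_trans t2)// -ltrBrDl.
  rewrite (is_derive_derive1 (dF k)) -RintegralB//; last 2 first.
  - apply: Rintegrable_within_continuous => t.
    by apply: cvgM; [exact: cw|exact: (continuous_subspaceT (cG _ _))].
  - apply: Rintegrable_within_continuous => t.
    by apply: cvgM; [exact: cw|exact: (continuous_subspaceT (cG _ _))].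
  have mw : measurable_fun `]0, T[ w.
    by apply: (Rintegrable_measurable (Rintegrable_within_continuous cw)).
  have mG l : measurable_fun `]0, T[ (G l k).
    apply: (@measurable_funTS _ _ _ _ `]0, T[); exact: continuous_measurable_fun.
  apply: ae_Rintegral => //.
  - by apply: measurable_funB; apply: measurable_funM => //; exact: mG.
  - apply: measurable_funM => //; apply: measurable_funD => //.
      exact: mG.
    by apply: measurable_funM => //; exact: mG.
  - by apply: ae_impl uw => t ut tT; rewrite ut//; ring.
have Fle k t : `|F k t| <= 1.
  rewrite /F mulN1r ler_norml.
  have := step_ge0 (K k * t + - (K k * l1 k)); have := step_le1 (K k * t + - (K k * l1 k)).
  have := step_ge0 (K k * t + - (K k * l2 k)); have := step_le1 (K k * t + - (K k * l2 k)).
  by rewrite -/(S l1 k t) -/(S l2 k t); lra.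

have idun : Rintegrable mu `]0, T[ (fun t => `|du t|) by exact: integrable_norm.
have idub : Rintegrable mu `]0, T[ (du \_ `]0, b]).
  rewrite /Rintegrable -restrict_EFin; apply/integrable_restrict => //.
  by apply: integrableS idu => //; exact: measurableI.
have C : \int[mu]_(t in `]0, T[) (du t * F k t) @[k --> \oo] -->
    \int[mu]_(t in `]0, b]) du t.
  have -> : \int[mu]_(t in `]0, b]) du t = \int[mu]_(t in `]0, T[) (du \_ `]0, b]) t.
    rewrite -Rintegral_mkcondr; congr Rintegral; apply/seteqP; split => t /=.
      by rewrite !in_itv /= => /andP[t0 tb]; rewrite t0 tb (le_lt_trans tb).
    by case.
  have mF k : measurable_fun `]0, T[ (F k).
    by apply: measurable_funTS; exact: continuous_measurable_fun.
  have := @dominated_convergence _ _ _ mu `]0, T[ _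
    (fun k => EFin \o (fun t => du t * F k t)) (EFin \o (du \_ `]0, b]))
    (fun t => `|du t|%:E).
  case=> //.
  - move=> k; apply/measurable_EFinP; apply: measurable_funM => //.
      exact: Rintegrable_measurable idu.
    exact: mF.
  - by apply/measurable_EFinP; exact: Rintegrable_measurable idub.
  - apply: aeW => t; rewrite /= in_itv /= => /andP[t0 tT].
    apply: cvg_EFin; first by apply: nearW.
    apply: (cvg_trans _ (cvg_cst ((du \_ `]0, b]) t))).
    have ht : 0 < t / 2 by rewrite divr_gt0.
    have F1 k : (K k)^-1 < t / 2 -> S l1 k t = 1.
      by move=> kt; rewrite S1// -lerBrDl /l1; move: (K k)^-1 kt => z; lra.
    rewrite patchE; have [tb|tb] := lerP t b.
      rewrite mem_set /= ?in_itv /= ?t0//; apply: near_eq_cvg; near=> k => /=; apply/esym.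
      rewrite /F F1 ?S0 ?mulr0 ?addr0 ?mulr1//.
      by near: k; exact: (near_infty_natSinv_lt (PosNum ht)).
    have hb : 0 < t - b by rewrite subr_gt0.
    rewrite memNset /= ?in_itv /= ?t0 /= 1?leNgt ?tb//.
    apply: near_eq_cvg; near=> k => /=; apply/esym.
    rewrite /F F1 ?S1 ?mulr1 ?subrr ?mulr0// /l2.
      by rewrite -lerBrDl ltW//; near: k; exact: (near_infty_natSinv_lt (PosNum hb)).
    by near: k; exact: (near_infty_natSinv_lt (PosNum ht)).
    exact: eventually_filter.
  - by apply: aeW => t k _ /=; rewrite lee_fin normrM ler_piMr.
  move=> _ _ h; apply: fine_cvg; rewrite /Rintegral fineK; first exact: h.
  exact: (integrable_fin_num _ idub).
have AB : \int[mu]_(t in `]0, T[) (w t * G l1 k t) -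
    \int[mu]_(t in `]0, T[) (w t * G l2 k t) @[k --> \oo] --> w 0 - w b.
  exact: cvgB.
have AC : \int[mu]_(t in `]0, T[) (w t * G l1 k t) -
    \int[mu]_(t in `]0, T[) (w t * G l2 k t) @[k --> \oo] -->
    - \int[mu]_(t in `]0, b]) du t.
  have Tb : 0 < T - b by rewrite subr_gt0.
  apply: cvg_trans (cvgN C); apply: near_eq_cvg; near=> k; apply/esym/FE.
    by near: k; exact: (near_infty_natSinv_lt (PosNum b0)).
  by near: k; exact: (near_infty_natSinv_lt (PosNum Tb)).
have E : w 0 - w b = - \int[mu]_(t in `]0, b]) du t by apply: (cvg_unique _ AB AC).
by move: E; rewrite w0 sub0r => E; apply: oppr_inj.
Unshelve. all: by end_near. Qed.

End du_bois_reymond.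

(** * Product rule and the weighted energy identity *)

Section product_rule.
Context {R : realType}.
Notation mu := (@lebesgue_measure R).
Implicit Types (f g F G u w : R -> R) (a b t T : R).

(** Both sides are the integral of [f x * g y] over the triangle [y < x]. *)
Lemma Rintegral_triangle_swap f g : Rintegrable mu setT f -> Rintegrable mu setT g ->
  \int[mu]_x (f x * \int[mu]_(y in `]-oo, x[) g y) =
  \int[mu]_y (g y * \int[mu]_(x in `]y, +oo[) f x).
Proof.
move=> fi gi.
have mf : measurable_fun setT f := Rintegrable_measurable fi.
have mg : measurable_fun setT g := Rintegrable_measurable gi.
pose k (z : measurableTypeR R * measurableTypeR R) : R :=
  if z.2 < z.1 then f z.1 * g z.2 else 0.
have mk : measurable_fun setT k.
  apply: measurable_fun_ifT; last exact: measurable_cst.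
    exact: measurable_fun_ltr.
  by apply: measurable_funM; apply: measurableT_comp.
have mK : measurable_fun setT (EFin \o k) by exact/measurable_EFinP.
have ik : (mu \x mu)%E.-integrable setT (EFin \o k).
  apply/integrable12ltyP => //.
  pose C := \int[mu]_y `|g y|.
  apply: (@le_lt_trans _ _ (\int[mu]_x (`|C * f x|)%:E)%E); last first.
    by have /integrableP[_] := RintegrableZ measurableT C fi.
  apply: ge0_le_integral => //.
  - by move=> x _; apply: integral_ge0.
  - apply: (@measurable_fun_fubini_tonelli_F _ _ _ _ _ mu (abse \o (EFin \o k))) => //.
      exact: measurableT_comp.
    by move=> z; exact: abse_ge0.
  - by apply/measurable_EFinP; apply: measurableT_comp => //; exact: measurable_funM.
  - move=> x _; have iCg : Rintegrable mu setT (fun y => `|f x| * `|g y|).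
      by apply: RintegrableZ => //; exact: integrable_norm.
    have -> : `|C * f x| = \int[mu]_y (`|f x| * `|g y|).
      rewrite RintegralZl//; last exact: integrable_norm.
      rewrite normrM mulrC [`|C|]ger0_norm//; by apply: Rintegral_ge0 => y _; exact: normr_ge0.
    rewrite /Rintegral fineK; last exact: integrable_fin_num.
    apply: ge0_le_integral => //.
    + apply/measurable_EFinP; apply: measurableT_comp => //.
      apply: measurable_fun_ifT; last exact: measurable_cst.
        by apply: measurable_fun_ltr => //=; exact: measurable_cst.
      apply: measurable_funM => /=; first exact: measurable_cst.
      exact: mg.
    + by apply/measurable_EFinP; exact: (Rintegrable_measurable iCg).
    + move=> y _; rewrite lee_fin /k /=; case: ifP => _; first by rewrite normrM.
      by rewrite normr0 mulr_ge0.
have gr x : Rintegrable mu setT (g \_ `]-oo, x[).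
  rewrite /Rintegrable -restrict_EFin; apply/integrable_restrict => //; rewrite setTI.
  exact: integrableS gi.
have fr y : Rintegrable mu setT (f \_ `]y, +oo[).
  rewrite /Rintegrable -restrict_EFin; apply/integrable_restrict => //; rewrite setTI.
  exact: integrableS fi.
have E := Fubini ik; apply: (congr1 fine).
transitivity (\int[mu]_x \int[mu]_y (EFin \o k) (x, y))%E.
  apply: eq_integral => x _.
  rewrite Rintegral_mkcond -RintegralZl//; last exact: gr.
  rewrite [LHS](EFin_Rintegral measurableT (RintegrableZ measurableT (f x) (gr x))).
  apply: eq_integral => y _; rewrite /k /= patchE.
  have [xy|xy] := ltP y x; first by rewrite mem_set //= in_itv.
  by rewrite memNset ?mulr0 //= in_itv /= ltNge xy.
apply: (etrans E); apply: eq_integral => y _; apply/esym.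
rewrite Rintegral_mkcond -RintegralZl//; last exact: fr.
rewrite [LHS](EFin_Rintegral measurableT (RintegrableZ measurableT (g y) (fr y))).
apply: eq_integral => x _; rewrite /k /= patchE.
have [xy|xy] := ltP y x; first by rewrite mem_set //= ?in_itv /= ?andbT// mulrC.
by rewrite memNset ?mulr0 //= in_itv /= andbT ltNge xy.
Qed.

(** By the exchange of integrals on the triangle, the integral of [f G] is that of
    [(total of f - F) g]. *)
Lemma Rintegral_product_rule T f g F G : 0 < T ->
  Rintegrable mu `]0, T[ f -> Rintegrable mu `]0, T[ g ->
  {within `[0, T], continuous F} -> {within `[0, T], continuous G} ->
  (forall t, 0 < t < T -> F t = \int[mu]_(s in `]0, t]) f s) ->
  (forall t, 0 < t < T -> G t = \int[mu]_(s in `]0, t]) g s) ->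
  [/\ Rintegrable mu `]0, T[ (fun t => f t * G t), Rintegrable mu `]0, T[ (fun t => F t * g t) &
  \int[mu]_(t in `]0, T[) (f t * G t + F t * g t) =
  (\int[mu]_(t in `]0, T[) f t) * \int[mu]_(t in `]0, T[) g t].
Proof.
move=> T0 fi gi cF cG FE GE.
have bnd (H : R -> R) : {within `[0, T], continuous H} ->
    exists M : R, forall t, `]0, T[%classic t -> `|H t| <= M.
  move=> cH.
  have /compact_bounded[M [_ hM]] : compact (H @` `[0, T] : set R^o).
    by apply: continuous_compact => //; exact: segment_compact.
  exists (M + 1) => t tT; apply: (hM (M + 1)); first by rewrite ltrDl.
  by exists t => //; exact: subset_itv_oo_cc.
have i1 : Rintegrable mu `]0, T[ (fun t => f t * G t).
  have [M hM] := bnd G cG; apply: (@Rintegrable_bounded_mul _ _ _ mu `]0, T[ _ f G M) => //.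
  exact: (Rintegrable_measurable (Rintegrable_within_continuous cG)).
have i2 : Rintegrable mu `]0, T[ (fun t => F t * g t).
  rewrite (_ : (fun t => F t * g t) = (fun t => g t * F t)); last first.
    by apply/funext => t; rewrite mulrC.
  have [M hM] := bnd F cF; apply: (@Rintegrable_bounded_mul _ _ _ mu `]0, T[ _ g F M) => //.
  exact: (Rintegrable_measurable (Rintegrable_within_continuous cF)).
split => //; rewrite RintegralD//.
pose f' := f \_ `]0, T[; pose g' := g \_ `]0, T[.
have fi' : Rintegrable mu setT f'.
  by rewrite /Rintegrable -restrict_EFin; apply/integrable_restrict => //; rewrite setTI.
have gi' : Rintegrable mu setT g'.
  by rewrite /Rintegrable -restrict_EFin; apply/integrable_restrict => //; rewrite setTI.
have := Rintegral_triangle_swap fi' gi'.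
have -> : \int[mu]_x (f' x * \int[mu]_(y in `]-oo, x[) g' y) =
    \int[mu]_(t in `]0, T[) (f t * G t).
  rewrite [RHS]Rintegral_mkcond; apply: eq_Rintegral => x _.
  rewrite /f' !patchE; case: ifPn => [|_]; last by rewrite mul0r.
  rewrite inE /= in_itv /= => /andP[x0 xT]; congr (_ * _).
  rewrite GE ?x0// -Rintegral_itv_bndo_bndc; last first.
    by apply: integrableS gi => //; apply: subset_itvl; rewrite bnd_simp ltW.
  rewrite -Rintegral_mkcondr; congr Rintegral; apply/seteqP; split => t /=.
    by rewrite !in_itv /= => -[-> /andP[->]].
  by rewrite !in_itv /= => /andP[-> tx]; rewrite tx (lt_trans tx).
have -> : \int[mu]_y (g' y * \int[mu]_(x in `]y, +oo[) f' x) =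
    \int[mu]_(t in `]0, T[) (\int[mu]_(t in `]0, T[) f t * g t - F t * g t).
  rewrite [RHS]Rintegral_mkcond; apply: eq_Rintegral => x _.
  rewrite /g' !patchE; case: ifPn => [|_]; last by rewrite mul0r.
  rewrite inE /= in_itv /= => /andP[x0 xT]; rewrite -mulrBl mulrC; congr (_ * _).
  rewrite FE ?x0// (Rintegral_itvB fi) ?bnd_simp ?ltW//.
  rewrite -Rintegral_mkcondr; congr Rintegral; apply/seteqP; split => t /=.
    by rewrite !in_itv /= andbT => -[-> /andP[_ ->]].
  by rewrite !in_itv /= andbT => /andP[xt tT]; rewrite xt tT (lt_trans x0).
move=> ->; rewrite RintegralB//; last exact: RintegrableZ.
by rewrite subrK RintegralZl.
Qed.

(** The boundary condition at 0 removes the constant of integration. *)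
Lemma H10_time_primitive T (p : sobolev_time R) : 0 < T -> H10_time T p ->
  Rintegrable mu `]0, T[ p.2 /\ exists P : R -> R,
  [/\ {within `[0, T], continuous P},
      forall t, 0 < t < T -> P t = \int[mu]_(s in `]0, t]) p.2 s &
      {ae mu, forall t, `]0, T[%classic t -> p.1 t = P t}].
Proof.
move=> T0 [[L1 L2p wd] [w [cw w0 pw]]].
have ip2 : Rintegrable mu `]0, T[ p.2.
  have h := @RintegrableD _ _ _ mu `]0, T[ (measurable_itv _) (fun t => p.2 t ^+ 2) (fun=> 1).
  apply: (@le_Rintegrable _ _ _ mu _ _ _ (fun t => p.2 t ^+ 2 + 1)) => //.
  - by case: L2p.
  - apply: h; first exact: L2_Rintegrable_sqr.
    by apply: Rintegrable_within_continuous => t; exact: cst_continuous.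
  - move=> t _; rewrite -(real_normK (num_real (p.2 t))).
    by have := sqr_ge0 (`|p.2 t| - 1); nra.
split => //; exists w; split => // t tT.
by apply: (weak_derivative_primitive T0 _ ip2 wd cw w0 pw tT); case: L1.
Qed.

Lemma weight_integrable T (h : R -> R) : 0 < T -> Rintegrable mu `]0, T[ h ->
  Rintegrable mu `]0, T[ (fun t => h t * expR (- t / T)).
Proof.
move=> T0 ih; have hE : measurable_fun `]0, T[ (fun t => expR (- t / T)).
  rewrite (_ : (fun t => _) = (fun t : R => expR (t * - T^-1))); last first.
    by apply/funext => t; rewrite mulNr mulrN.
  by apply: measurableT_comp => //; apply: measurable_funM.
apply: (@Rintegrable_bounded_mul _ _ _ mu `]0, T[ _ h _ 1) => // t.
rewrite /= in_itv /= => /andP[t0 _].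
rewrite ger0_norm ?expR_ge0// -expR0 ler_expR mulNr oppr_le0.
by rewrite divr_ge0 ?ltW.
Qed.

(** The product rule is used twice: for the product of the primitives of [p.2] and [q.2],
    and for this product times the weight minus 1, which vanishes at 0. *)
Lemma weighted_int_by_parts T (p q : sobolev_time R) : 0 < T ->
  H10_time T p -> H10_time T q ->
  weighted_int T (fun t => p.1 t * q.2 t) + weighted_int T (fun t => p.2 t * q.1 t) =
  expR (-1) * (\int[mu]_(t in `]0, T[) p.2 t * \int[mu]_(t in `]0, T[) q.2 t)
  + T^-1 * weighted_int T (fun t => p.1 t * q.1 t).
Proof.
move=> T0 Hp Hq.
have [ip [P [cP PE pP]]] := H10_time_primitive T0 Hp.
have [iq [Q [cQ QE qQ]]] := H10_time_primitive T0 Hq.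
have mp1 : measurable_fun `]0, T[ p.1 by case: Hp => -[[]].
have mp2 : measurable_fun `]0, T[ p.2 by case: Hp => -[_ []].
have mq1 : measurable_fun `]0, T[ q.1 by case: Hq => -[[]].
have mq2 : measurable_fun `]0, T[ q.2 by case: Hq => -[_ []].
have mP : measurable_fun `]0, T[ P := Rintegrable_measurable (Rintegrable_within_continuous cP).
have mQ : measurable_fun `]0, T[ Q := Rintegrable_measurable (Rintegrable_within_continuous cQ).
pose E t := expR (- t / T); pose E' t := - T^-1 * expR (- t / T).
have dE t : is_derive t (1 : R) (fun t => E t - 1) (E' t).
  have da : is_derive t (1 : R) (fun t => expR (- T^-1 * t + 0)) (- T^-1 * expR (- T^-1 * t + 0)).
    by apply: is_derive_affine => s; exact: is_derive_expR.
  have -> : (fun t => E t - 1) = (fun t => expR (- T^-1 * t + 0)) - cst 1.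
    by apply/funext => s; rewrite /E !fctE addr0 mulNr mulNr mulrC.
  apply: is_derive_eq.
  by rewrite /E' addr0 subr0; congr (_ * expR _); rewrite mulNr mulrC mulNr.
have cE : continuous (fun t => E t - 1) by exact: is_derive_continuous dE.
have cE0 : continuous E.
  have -> : E = (fun t => (E t - 1) + 1) by apply/funext => t; rewrite subrK.
  by move=> t; apply: cvgD; [exact: cE|exact: cvg_cst].
have cE' : continuous E'.
  by move=> t; apply: cvgM; [exact: cvg_cst|exact: cE0].
have mE : measurable_fun `]0, T[ E.
  by apply: measurable_funTS; exact: continuous_measurable_fun.
have mfE (f g : R -> R) : measurable_fun `]0, T[ f -> measurable_fun `]0, T[ g ->
    measurable_fun `]0, T[ (fun t => f t * g t * E t).
  by move=> mf mg; apply: measurable_funM; [exact: measurable_funM|exact: mE].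
have [iPQ1 iPQ2 IPQ] := Rintegral_product_rule T0 ip iq cP cQ PE QE.
pose h t := p.2 t * Q t + P t * q.2 t; pose H t := P t * Q t.
have ih : Rintegrable mu `]0, T[ h by exact: RintegrableD.
have cH : {within `[0, T], continuous H}.
  by move=> t; apply: cvgM; [exact: cP|exact: cQ].
have HE t : 0 < t < T -> H t = \int[mu]_(s in `]0, t]) h s.
  move=> /andP[t0 tT].
  have sub : `]0, t[ `<=` `]0, T[ by apply: subset_itvl; rewrite bnd_simp ltW.
  have subc : `[0, t] `<=` `[0, T] by apply: subset_itvl; rewrite bnd_simp ltW.
  have ip' : Rintegrable mu `]0, t[ p.2 by apply: integrableS ip.
  have iq' : Rintegrable mu `]0, t[ q.2 by apply: integrableS iq.
  have [||||_ _] := Rintegral_product_rule t0 ip' iq' (F := P) (G := Q).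
  - exact: continuous_subspaceW subc cP.
  - exact: continuous_subspaceW subc cQ.
  - by move=> s /andP[s0 st]; apply: PE; rewrite s0 (lt_trans st).
  - by move=> s /andP[s0 st]; apply: QE; rewrite s0 (lt_trans st).
  rewrite (Rintegral_itv_bndo_bndc ip') (Rintegral_itv_bndo_bndc iq').
  rewrite Rintegral_itv_bndo_bndc; last by apply: integrableS ih.
  by rewrite /H PE ?t0// QE ?t0//.
have iE' : Rintegrable mu `]0, T[ E'.
  by apply: Rintegrable_within_continuous; exact: continuous_subspaceT.
have EE t : 0 < t < T -> E t - 1 = \int[mu]_(s in `]0, t]) E' s.
  move=> /andP[t0 tT]; rewrite -Rintegral_itv_bndo_bndc; last first.
    by apply: Rintegrable_within_continuous; exact: continuous_subspaceT.
  rewrite (Rintegral_oo_derive t0 dE cE') /E oppr0 mul0r expR0 subrr subr0//.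
have [i1 i2] := Rintegral_product_rule T0 ih iE' cH (continuous_subspaceT cE) HE EE.
rewrite (Rintegral_oo_derive T0 dE cE') IPQ.
have -> : E 0 - 1 = 0 by rewrite /E oppr0 mul0r expR0 subrr.
have -> : E T = expR (-1) by rewrite /E mulNr divff// gt_eqF.
rewrite subr0 RintegralD// => I2.
have iHE : Rintegrable mu `]0, T[ (fun t => H t * E t).
  apply: Rintegrable_within_continuous => t; apply: cvgM; first exact: cH.
  exact: (continuous_subspaceT cE0).
have W1 : weighted_int T (fun t => p.1 t * q.1 t) = \int[mu]_(t in `]0, T[) (H t * E t).
  apply: ae_Rintegral => //; [exact: mfE..|].
  apply: ae_impl (ae_and pP qQ) => t [h1 h2] tT.
  by rewrite h1// h2.
have iPE : Rintegrable mu `]0, T[ (fun t => P t * q.2 t * E t) by exact: weight_integrable.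
have iQE : Rintegrable mu `]0, T[ (fun t => p.2 t * Q t * E t) by exact: weight_integrable.
have W2 : weighted_int T (fun t => p.1 t * q.2 t) = \int[mu]_(t in `]0, T[) (P t * q.2 t * E t).
  apply: ae_Rintegral => //; [exact: mfE..|].
  by apply: ae_impl pP => t h1 tT; rewrite h1.
have W3 : weighted_int T (fun t => p.2 t * q.1 t) = \int[mu]_(t in `]0, T[) (p.2 t * Q t * E t).
  apply: ae_Rintegral => //; [exact: mfE..|].
  by apply: ae_impl qQ => t h1 tT; rewrite h1.
(* Rearrange the second product rule, whose right-hand side is the product of the
   totals with [exp (- 1) - 1]. *)
rewrite W1 W2 W3 -RintegralD//.
have e1 : \int[mu]_(t in `]0, T[) (h t * (E t - 1)) =
    \int[mu]_(t in `]0, T[) (P t * q.2 t * E t + p.2 t * Q t * E t) -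
    \int[mu]_(t in `]0, T[) h t.
  rewrite -RintegralB//; last exact: RintegrableD.
  by apply: eq_Rintegral => t _; rewrite /h; ring.
have e2 : \int[mu]_(t in `]0, T[) (H t * E' t) = - T^-1 * \int[mu]_(t in `]0, T[) (H t * E t).
  rewrite -RintegralZl//.
  by apply: eq_Rintegral => t _; rewrite /E' /E; ring.
move: I2; rewrite e1 e2 [\int[mu]_(t in _) h t]IPQ.
move: (\int[mu]_(t in _) (_ + _)) => X.
move: (\int[mu]_(t in _) (_ * _)) => Y.
move: (expR (-1)) (\int[mu]_(t in _) p.2 t) (\int[mu]_(t in _) q.2 t) (T^-1).
move=> e A B i I2; lra.
Qed.

End product_rule.

(** * Semi-inner products and Galerkin equations *)

Section semi_inner_product.
Context {R : realType} {E : lmodType R}.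

Definition subspace_closed (S : set E) :=
  S 0 /\ forall (a : R) u v, S u -> S v -> S (a *: u + v).

Definition semi_inner (S : set E) (b : E -> E -> R) :=
  [/\ forall a u v z, S u -> S v -> S z -> b (a *: u + v) z = a * b u z + b v z,
      forall u z, S u -> S z -> b u z = b z u &
      forall u, S u -> 0 <= b u u].

Variables (S : set E) (b : E -> E -> R).
Hypotheses (hS : subspace_closed S) (hb : semi_inner S b).

Lemma semi_inner_linl a u v z : S u -> S v -> S z ->
  b (a *: u + v) z = a * b u z + b v z.
Proof. by case: hb => h _ _; exact: h. Qed.

Lemma semi_innerC u z : S u -> S z -> b u z = b z u.
Proof. by case: hb => _ h _; exact: h. Qed.

Lemma semi_inner_ge0 u : S u -> 0 <= b u u.
Proof. by case: hb => _ _ h; exact: h. Qed.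

Lemma semi_inner_linr a u v z : S u -> S v -> S z ->
  b z (a *: u + v) = a * b z u + b z v.
Proof.
move=> Su Sv Sz; rewrite semi_innerC//; last by case: hS => _; exact.
by rewrite semi_inner_linl// (semi_innerC Su Sz) (semi_innerC Sv Sz).
Qed.

Lemma subspace_closed_sum n (a : 'I_n -> R) (w : 'I_n -> E) :
  (forall i, S (w i)) -> S (\sum_i a i *: w i).
Proof.
case: hS => S0 Slin Sw.
by apply: (big_ind S) => // [u v Su Sv|i _];
  [rewrite -[u]scale1r; exact: Slin|rewrite -[_ *: _]addr0; exact: Slin].
Qed.

Lemma semi_inner0l z : S z -> b 0 z = 0.
Proof.
case: (hS) => S0 _ Sz; have := semi_inner_linl 1 S0 S0 Sz.
by rewrite scale1r addr0 mul1r => /eqP; rewrite -subr_eq0 opprD addrA subrr sub0r oppr_eq0 => /eqP.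
Qed.

Lemma semi_inner_suml n (a : 'I_n -> R) (w : 'I_n -> E) z :
  (forall i, S (w i)) -> S z -> b (\sum_i a i *: w i) z = \sum_i a i * b (w i) z.
Proof.
move=> Sw Sz; elim: n a w Sw => [|n IH] a w Sw.
  by rewrite !big_ord0 semi_inner0l.
rewrite !big_ord_recl semi_inner_linl//; last exact: subspace_closed_sum.
by rewrite IH.
Qed.

Lemma semi_inner_sumr n (a : 'I_n -> R) (w : 'I_n -> E) z :
  (forall i, S (w i)) -> S z -> b z (\sum_i a i *: w i) = \sum_i a i * b z (w i).
Proof.
move=> Sw Sz; rewrite semi_innerC//; last exact: subspace_closed_sum.
by rewrite semi_inner_suml//; apply: eq_bigr => i _; rewrite semi_innerC.
Qed.

Lemma semi_inner_sum2 n k (a : 'I_n -> R) (w : 'I_n -> E) (a' : 'I_k -> R) (w' : 'I_k -> E) :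
  (forall i, S (w i)) -> (forall i, S (w' i)) ->
  b (\sum_i a i *: w i) (\sum_j a' j *: w' j) =
  \sum_i \sum_j a i * a' j * b (w i) (w' j).
Proof.
move=> Sw Sw'; rewrite semi_inner_suml//; last exact: subspace_closed_sum.
apply: eq_bigr => i _; rewrite semi_inner_sumr// mulr_sumr.
by apply: eq_bigr => j _; rewrite mulrA.
Qed.

(** Degenerate case of the Cauchy-Schwarz inequality: [s |-> b (s v + u) (s v + u)] is
    then affine, and an affine function that stays nonnegative is constant. *)
Lemma semi_inner_null u v : S u -> S v -> b v v = 0 -> b u v = 0.
Proof.
move=> Su Sv bv; apply/eqP/negPn/negP => uv0.
(* At this [s] the affine function takes the value - 1. *)
pose s := - (b u u + 1) / (2 * b u v).
have Sw : S (s *: v + u) by case: hS => _; exact.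
have := semi_inner_ge0 Sw.
rewrite semi_inner_linl// !semi_inner_linr// bv (semi_innerC Sv Su).
have -> : s * (s * 0 + b u v) + (s * b u v + b u u) = -1.
  by rewrite /s; field.
by rewrite lerNr oppr0 ler10.
Qed.

End semi_inner_product.

Section galerkin.
Context {R : realType} {E : lmodType R}.

(** The Gram matrix [G] of [a] may be singular: [b] need not be independent, even
    modulo null vectors.  The system is solvable since the right-hand side annihilates the kernel of
    [G]: a combination in this kernel has zero [a]-energy, hence zero [m]-energy by the
    comparison hypothesis, and is [m]-orthogonal to everything. *)
Lemma galerkin_solvable (S : set E) (a m : E -> E -> R) (K : R) n (b : 'I_n -> E) :
  subspace_closed S -> semi_inner S a -> semi_inner S m ->
  (forall u, S u -> m u u <= K * a u u) -> (forall i, S (b i)) ->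
  (forall u, S u -> exists al : 'I_n -> R, forall z, S z ->
     a z u = \sum_i al i * a z (b i) /\ m z u = \sum_i al i * m z (b i)) ->
  forall u, S u -> exists2 w, S w & forall v, S v -> a w v = m u v.
Proof.
move=> hS ha hm mK Sb bspan u Su.
pose G := \matrix_(i, j) a (b i) (b j).
pose f := \row_j m u (b j).
have : (f <= G)%MS.
  rewrite submxE; apply/eqP/rowP => j; rewrite [LHS]mxE [RHS]mxE.
  pose x i := cokermx G i j; pose v := \sum_i x i *: b i.
  have Sv : S v by exact: subspace_closed_sum.
  have Gx i : \sum_k a (b i) (b k) * x k = 0.
    have /matrixP/(_ i j) := mulmx_coker G; rewrite [LHS]mxE [RHS]mxE; apply: etrans.
    by apply: eq_bigr => k _; rewrite [G _ _]mxE.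
  have av : a v v = 0.
    rewrite (semi_inner_sum2 hS ha)// big1// => i _.
    transitivity (x i * \sum_k a (b i) (b k) * x k); last by rewrite Gx mulr0.
    rewrite mulr_sumr.
    by apply: eq_bigr => k _; ring.
  have mv : m v v = 0.
    apply/eqP; rewrite eq_le (semi_inner_ge0 hm Sv) andbT.
    by apply: le_trans (mK v Sv) _; rewrite av mulr0.
  have := semi_inner_null hS hm Su Sv mv; rewrite (semi_inner_sumr hS hm)//; apply: etrans.
  by apply: eq_bigr => k _; rewrite [f _ _]mxE mulrC.
case/submxP => D fE.
have Sw : S (\sum_i D 0 i *: b i) by exact: subspace_closed_sum.
exists (\sum_i D 0 i *: b i) => // v Sv.
have [al hal] := bspan v Sv.
rewrite (hal _ Sw).1 (hal _ Su).2; apply: eq_bigr => j _; congr (_ * _).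
have /rowP/(_ j) := fE; rewrite [LHS]mxE [RHS]mxE => ->.
rewrite (semi_inner_suml hS ha)//; apply: eq_bigr => i _; by rewrite [G _ _]mxE.
Qed.

End galerkin.

(** * Forms on functions of time with values in a space *)

Section tensor_evolutions.
Context {R : realType} {E : lmodType R} (T : R).
Notation mu := (@lebesgue_measure R).
Notation I := (`]0, T[%classic : set R).
Implicit Types (S : set E) (b : E -> E -> R) (L M : R -> E).

(** Algebraic tensor product of a space of vectors and a space of functions of time;
    with time derivatives of trial functions for [Q] it is the test space [dQh]. *)
Definition tensor_evol S (Q : set (R -> R)) : set (R -> E) :=
  [set L | exists (n : nat) (w : 'I_n -> E) (q : 'I_n -> R -> R),
    [/\ forall i, S (w i), forall i, Q (q i) &
        L = (fun t => \sum_i q i t *: w i)]].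

Definition wform b L M : R := weighted_int T (fun t => b (L t) (M t)).

Lemma tensor_evol_in S Q L t : subspace_closed S -> tensor_evol S Q L -> S (L t).
Proof. by move=> hS [n [w [q [Sw _ ->]]]]; exact: subspace_closed_sum. Qed.

Lemma split_lshift n k (i : 'I_n) : fintype.split (lshift k i) = inl i.
Proof. exact: (unsplitK (inl i)). Qed.

Lemma split_rshift n k (i : 'I_k) : fintype.split (rshift n i) = inr i.
Proof. exact: (unsplitK (inr i)). Qed.

(** The sum of two tensors is their concatenation. *)
Lemma tensor_evol_closed S Q : subspace_closed S -> subspace_closed (tensor_evol S Q).
Proof.
move=> [S0 Slin]; split.
  exists 0%N, (fun=> 0), (fun=> cst 0); split => [i|[]//|]; first by [].
  by apply/funext => t; rewrite big_ord0.
move=> a L M [n [w [q [Sw Lq ->]]]] [k [w' [q' [Sw' Lq' ->]]]].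
exists (n + k)%N, (fun i => match fintype.split i with inl j => a *: w j | inr j => w' j end),
  (fun i => match fintype.split i with inl j => q j | inr j => q' j end); split.
- move=> i; case: fintype.split => j //; rewrite -[_ *: _]addr0; exact: Slin.
- by move=> i; case: fintype.split.
- apply/funext => t; rewrite big_split_ord /=; congr (_ + _).
    transitivity (a *: \sum_i q i t *: w i) => //; rewrite scaler_sumr.
    by apply: eq_bigr => i _; rewrite split_lshift !scalerA mulrC.
  by apply: eq_bigr => i _; rewrite split_rshift.
Qed.

Hypothesis T0 : 0 < T.

Section one_form.
Variables (S : set E) (b : E -> E -> R).
Hypotheses (hS : subspace_closed S) (hb : semi_inner S b).

Lemma tensor_form_integrable L M : tensor_evol S (L2 mu I) L -> tensor_evol S (L2 mu I) M ->
  Rintegrable mu I (fun t => b (L t) (M t) * expR (- t / T)).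
Proof.
move=> [n [w [q [Sw Lq ->]]]] [k [w' [q' [Sw' Lq' ->]]]].
apply: (weight_integrable T0).
have -> : (fun t => b (\sum_i q i t *: w i) (\sum_i q' i t *: w' i)) =
    (fun t => \sum_i \sum_j b (w i) (w' j) * (q i t * q' j t)).
  apply/funext => t; rewrite (semi_inner_sum2 hS hb)//.
  by apply: eq_bigr => i _; apply: eq_bigr => j _; rewrite mulrC.
apply: Rintegrable_sum => // i _; apply: Rintegrable_sum => // j _; apply: RintegrableZ => //.
exact: L2_Rintegrable_mul.
Qed.

Lemma wform_sum n k (w : 'I_n -> E) (w' : 'I_k -> E) (q : 'I_n -> R -> R)
    (q' : 'I_k -> R -> R) :
  (forall i, S (w i)) -> (forall i, S (w' i)) ->
  (forall i, L2 mu I (q i)) -> (forall i, L2 mu I (q' i)) ->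
  wform b (fun t => \sum_i q i t *: w i) (fun t => \sum_i q' i t *: w' i) =
  \sum_i \sum_j b (w i) (w' j) * weighted_int T (fun t => q i t * q' j t).
Proof.
move=> Sw Sw' Lq Lq'; rewrite /wform /weighted_int.
have iqq i j : Rintegrable mu I (fun t => q i t * q' j t * expR (- t / T)).
  by apply: (weight_integrable T0); exact: L2_Rintegrable_mul.
under eq_Rintegral do rewrite (semi_inner_sum2 hS hb)// mulr_suml.
have ibq i j : Rintegrable mu I (fun t => q i t * q' j t * b (w i) (w' j) * expR (- t / T)).
  rewrite (_ : (fun t => _) = (fun t => b (w i) (w' j) * (q i t * q' j t * expR (- t / T)))).
    exact: RintegrableZ.
  by apply/funext => t; ring.
have ibqs i : Rintegrable mu I (fun t => \sum_j q i t * q' j t * b (w i) (w' j) * expR (- t / T)).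
  exact: Rintegrable_sum.
transitivity (\int[mu]_(t in I)
    \sum_i \sum_j q i t * q' j t * b (w i) (w' j) * expR (- t / T)).
  by apply: eq_Rintegral => t _; apply: eq_bigr => i _; rewrite mulr_suml.
rewrite Rintegral_sum//; apply: eq_bigr => i _; rewrite Rintegral_sum//.
apply: eq_bigr => j _; rewrite -RintegralZl//; last exact: iqq.
by apply: eq_Rintegral => t _; ring.
Qed.

Lemma wform_semi_inner : semi_inner (tensor_evol S (L2 mu I)) (wform b).
Proof.
split.
- move=> a L M Z hL hM hZ; rewrite /wform /weighted_int.
  have i1 := tensor_form_integrable hL hZ; have i2 := tensor_form_integrable hM hZ.
  rewrite -RintegralZl// -RintegralD//; last exact: RintegrableZ.
  apply: eq_Rintegral => t _.
  by rewrite (semi_inner_linl hb _ (tensor_evol_in t hS hL) (tensor_evol_in t hS hM)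
     (tensor_evol_in t hS hZ)) mulrDl mulrA.
- move=> L M hL hM; congr weighted_int; apply/funext => t.
  by rewrite (semi_innerC hb (tensor_evol_in t hS hL) (tensor_evol_in t hS hM)).
- move=> L hL; apply: Rintegral_ge0 => t _; rewrite mulr_ge0 ?expR_ge0//.
  exact: (semi_inner_ge0 hb (tensor_evol_in _ hS hL)).
Qed.

Lemma wform_eq0_ae L : tensor_evol S (L2 mu I) L -> wform b L L = 0 ->
  {ae mu, forall t, I t -> b (L t) (L t) = 0}.
Proof.
move=> hL h0.
have := Rintegral_eq0_ae _ (tensor_form_integrable hL hL) _ h0.
move=> /(_ (measurable_itv _)) h; apply: ae_impl (h _) => t.
  by move=> + It => /(_ It) /eqP; rewrite mulf_eq0 expR_eq0 orbF => /eqP.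
move=> _; rewrite mulr_ge0 ?expR_ge0//.
exact: (semi_inner_ge0 hb (tensor_evol_in _ hS hL)).
Qed.

Lemma ae_wform_eq0 L : {ae mu, forall t, I t -> b (L t) (L t) = 0} ->
  tensor_evol S (L2 mu I) L -> wform b L L = 0.
Proof.
move=> h hL; rewrite /wform /weighted_int (@ae_Rintegral _ _ _ mu I _ _ (fun=> 0))//.
- by rewrite Rintegral_cst// mul0r.
- exact: Rintegrable_measurable (tensor_form_integrable hL hL).
- by apply: ae_impl h => t ht It; rewrite ht// mul0r.
Qed.

(** Polarized over the coefficients, the weighted integration by parts writes
    [b(U, dU) + b(dU, U)] as [b(U, U) / T] plus the form [b] at the end value of [U] times
    [exp (- 1)], and this boundary term is nonnegative. *)
Lemma wform_energy n (w : 'I_n -> E) (p : 'I_n -> sobolev_time R) :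
  (forall i, S (w i)) -> (forall i, H10_time T (p i)) ->
  wform b (fun t => \sum_i (p i).1 t *: w i) (fun t => \sum_i (p i).1 t *: w i)
  <= 2 * T * wform b (fun t => \sum_i (p i).1 t *: w i) (fun t => \sum_i (p i).2 t *: w i).
Proof.
move=> Sw Hp.
have L1 i : L2 mu I (p i).1 by case: (Hp i) => -[].
have L2' i : L2 mu I (p i).2 by case: (Hp i) => -[].
rewrite !wform_sum//.
pose e i := \int[mu]_(t in `]0, T[) (p i).2 t.
have ee : 0 <= b (\sum_i e i *: w i) (\sum_i e i *: w i).
  by apply: (semi_inner_ge0 hb); exact: subspace_closed_sum.
rewrite (semi_inner_sum2 hS hb)// in ee.
set X := \sum_i \sum_j _ * weighted_int T (fun t => (p i).1 t * (p j).1 t).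
set Y := \sum_i \sum_j _ * weighted_int T (fun t => (p i).1 t * (p j).2 t).
have Y2 : Y = \sum_i \sum_j b (w i) (w j) * weighted_int T (fun t => (p i).2 t * (p j).1 t).
  rewrite /Y exchange_big; apply: eq_bigr => i _; apply: eq_bigr => j _ /=.
  rewrite (semi_innerC hb)//; congr (_ * weighted_int T _).
  by apply/funext => t; rewrite mulrC.
have : Y + Y = expR (-1) * (\sum_i \sum_j e i * e j * b (w i) (w j)) + T^-1 * X.
  rewrite {2}Y2 /Y /X !mulr_sumr -!big_split; apply: eq_bigr => i _ /=.
  rewrite !mulr_sumr -!big_split; apply: eq_bigr => j _ /=.
  by rewrite -mulrDr weighted_int_by_parts// /e; ring.
move: ee; move: (\sum_i _) => Z Z0 YY.
have : T^-1 * X <= Y + Y by rewrite YY lerDr mulr_ge0// expR_ge0.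
by rewrite mulrC ler_pdivrMr//; lra.
Qed.

End one_form.

Lemma wform_le S b b' K L : subspace_closed S -> semi_inner S b -> semi_inner S b' ->
  (forall u, S u -> b u u <= K * b' u u) -> tensor_evol S (L2 mu I) L ->
  wform b L L <= K * wform b' L L.
Proof.
move=> hS hb hb' bb' hL; rewrite /wform /weighted_int.
have i1 := tensor_form_integrable hS hb hL hL.
have i2 := tensor_form_integrable hS hb' hL hL.
rewrite -RintegralZl//; apply: le_Rintegral => //; first exact: RintegrableZ.
move=> t _; rewrite mulrA ler_wpM2r ?expR_ge0// bb'//.
exact: (tensor_evol_in t hS hL).
Qed.

End tensor_evolutions.

(** * Mass, stiffness and Newton potential *)

Section open_measurable.
Context {R : realType}.

(** An open set is the union of the boxes with rational centres and sides [2 / k] that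
    it contains. *)
Lemma open_measurable_rV n (A : set 'rV[R]_n) : open A -> measurable A.
Proof.
move=> oA.
pose box (u : 'rV[rat]_n * nat) : set 'rV[R]_n :=
  \bigcap_(i in [set: 'I_n]) ((fun x : 'rV[R]_n => x ord0 i) @^-1`
    `](ratr (u.1 ord0 i) - u.2.+1%:R^-1), (ratr (u.1 ord0 i) + u.2.+1%:R^-1)[).
have mbox u : measurable (box u).
  apply: fin_bigcap_measurable => [|i _]; first exact: finite_finset.
  by rewrite -[X in measurable X]setTI; exact: measurable_rV_coord.
have -> : A = \bigcup_u (if `[< box u `<=` A >] then box u else set0).
  apply/seteqP; split => [x Ax|x [u _]]; last by case: ifPn => // /asboolP; exact.
  have /nbhs_ballP[e /= e0 xeA] : nbhs x A by exact: open_nbhs_nbhs.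
  have [k ke] : exists k : nat, k.+1%:R^-1 < e / 2.
    have e2 : 0 < e / 2 by rewrite divr_gt0.
    have [k _ h] := near_infty_natSinv_lt (PosNum e2).
    by exists k; apply: h => /=.
  have k0 : (0 : R) < k.+1%:R^-1 by rewrite invr_gt0.
  have /choice[q hq] : forall i : 'I_n, exists q : rat,
      ratr q \in `](x ord0 i - k.+1%:R^-1), (x ord0 i + k.+1%:R^-1)[.
    by move=> i; apply: rat_in_itvoo; rewrite ltrD2l gtrN.
  have bA : box (\row_i q i, k) `<=` A.
    move=> y hy; apply: xeA; split => // i j; rewrite ord1.
    have := hy j I; rewrite /= mxE in_itv /= => /andP[y1 y2].
    have := hq j; rewrite in_itv /= => /andP[q1 q2].
    rewrite /ball /= ltr_norml; move: ke y1 y2 q1 q2.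
    move: (k.+1%:R^-1) (ratr (q j)) (x ord0 j) (y ord0 j) => K Q X Y.
    by move=> *; apply/andP; split; lra.
  exists (\row_i q i, k) => //; rewrite asboolT// => i _ /=; rewrite mxE in_itv /=.
  have := hq i; rewrite in_itv /= => /andP[q1 q2]; move: q1 q2.
  move: (k.+1%:R^-1) (ratr (q i)) (x ord0 i) => K Q X.
  by move=> *; apply/andP; split; lra.
apply: countable_bigcupT_measurable; first exact: countableP.
by move=> u; case: ifPn.
Qed.

End open_measurable.

Section spatial_forms.
Context {R : realType} {d : nat}.
Variables (Om : set 'rV[R]_d) (c : 'rV[R]_d -> R).
Notation mu := (lebesgue_rV d).
Hypothesis mOm : measurable Om.
Hypothesis cLinfty : Linfty mu Om c.
Implicit Types (S : set (sobolev R d)) (w z u v : sobolev R d).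

(** The part of [H1] on which the mass and stiffness forms are finite. *)
Definition L2_sobolev : set (sobolev R d) :=
  [set w | L2 mu Om (value w) /\ forall i, L2 mu Om (fun x => grad w x ord0 i)].

Definition mass w z : R := dotL2 Om (value w) (value z).

Definition stiffness w z : R :=
  dotL2v Om (fun x => c x ^+ 2 *: grad w x) (grad z).

Lemma mass_integrable w z : L2_sobolev w -> L2_sobolev z ->
  Rintegrable mu Om (fun x => value w x * value z x).
Proof. by move=> [hw _] [hz _]; exact: L2_Rintegrable_mul. Qed.

Lemma stiffness_integrable w z : L2_sobolev w -> L2_sobolev z ->
  Rintegrable mu Om (fun x => dotr (c x ^+ 2 *: grad w x) (grad z x)).
Proof.
move=> [_ hw] [_ hz].
rewrite (_ : (fun x => _) = fun x =>
  \sum_i (c x * grad w x ord0 i) * (c x * grad z x ord0 i)); last first.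
  apply/funext => x; apply: eq_bigr => i _; rewrite mxE; ring.
by apply: Rintegrable_sum => // i _; apply: L2_Rintegrable_mul => //; exact: L2_Linfty.
Qed.

Lemma grad_integrable w z : L2_sobolev w -> L2_sobolev z ->
  Rintegrable mu Om (fun x => dotr (grad w x) (grad z x)).
Proof. by move=> [_ hw] [_ hz]; apply: Rintegrable_sum => // i _; exact: L2_Rintegrable_mul. Qed.

Lemma mass_semi_inner S : S `<=` L2_sobolev -> semi_inner S mass.
Proof.
move=> SL; split.
- move=> a u v z /SL hu /SL hv /SL hz; rewrite /mass /dotL2.
  have i1 := mass_integrable hu hz; have i2 := mass_integrable hv hz.
  rewrite -RintegralZl// -RintegralD//; last exact: RintegrableZ.
  apply: eq_Rintegral => x _.
  have -> : value (a *: u + v) x = a * value u x + value v x by [].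
  by rewrite mulrDl mulrA.
- by move=> u z _ _; apply: eq_Rintegral => x _; rewrite mulrC.
- by move=> u _; apply: Rintegral_ge0 => x _; rewrite -expr2 sqr_ge0.
Qed.

Lemma stiffness_semi_inner S : S `<=` L2_sobolev -> semi_inner S stiffness.
Proof.
move=> SL; split.
- move=> a u v z /SL hu /SL hv /SL hz; rewrite /stiffness /dotL2v.
  have i1 := stiffness_integrable hu hz; have i2 := stiffness_integrable hv hz.
  rewrite -RintegralZl// -RintegralD//; last exact: RintegrableZ.
  apply: eq_Rintegral => x _.
  have -> : grad (a *: u + v) x = a *: grad u x + grad v x by [].
  rewrite /dotr mulr_sumr -big_split; apply: eq_bigr => i _ /=.
  by rewrite !mxE; ring.
- move=> u z _ _; apply: eq_Rintegral => x _; apply: eq_bigr => i _.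
  by rewrite !mxE; ring.
- move=> u _; apply: Rintegral_ge0 => x _; apply: sumr_ge0 => i _.
  by rewrite mxE -mulrA mulr_ge0 ?sqr_ge0// -expr2 sqr_ge0.
Qed.

Lemma mass_ae w u v : L2_sobolev w -> L2_sobolev u -> L2_sobolev v ->
  ae_eq_sobolev Om u v -> mass w u = mass w v.
Proof.
move=> hw hu hv uv; apply: ae_Rintegral => //.
- exact: (Rintegrable_measurable (mass_integrable hw hu)).
- exact: (Rintegrable_measurable (mass_integrable hw hv)).
- by apply: ae_impl uv => x h Ox; rewrite (h Ox).1.
Qed.

Lemma stiffness_ae w u v : L2_sobolev w -> L2_sobolev u -> L2_sobolev v ->
  ae_eq_sobolev Om u v -> stiffness w u = stiffness w v.
Proof.
move=> hw hu hv uv; apply: ae_Rintegral => //.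
- exact: (Rintegrable_measurable (stiffness_integrable hw hu)).
- exact: (Rintegrable_measurable (stiffness_integrable hw hv)).
- by apply: ae_impl uv => x h Ox; rewrite (h Ox).2.
Qed.

Lemma mass_eq0_ae u : L2_sobolev u -> mass u u = 0 ->
  {ae mu, forall x, Om x -> value u x = 0}.
Proof.
move=> hu h0; have := Rintegral_eq0_ae mOm (mass_integrable hu hu) _ h0.
move=> h; apply: ae_impl (h _) => x; last by move=> _; rewrite -expr2 sqr_ge0.
by move=> + Ox => /(_ Ox) /eqP; rewrite mulf_eq0 orbb => /eqP.
Qed.

Lemma ae_mass_eq0 u : L2_sobolev u ->
  {ae mu, forall x, Om x -> value u x = 0} -> mass u u = 0.
Proof.
move=> hu h; rewrite /mass /dotL2 (@ae_Rintegral _ _ _ mu Om _ _ (fun=> 0))//.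
- by rewrite Rintegral_cst// mul0r.
- exact: (Rintegrable_measurable (mass_integrable hu hu)).
- by apply: ae_impl h => x hx Ox; rewrite hx// mul0r.
Qed.

Lemma poincare_mass_stiffness (c0 COm : R) w : 0 < c0 -> 0 < COm ->
  {ae mu, forall x, Om x -> c0 <= c x} -> L2_sobolev w ->
  normL2 Om (value w) <= COm * normL2v Om (grad w) ->
  mass w w <= COm ^+ 2 / c0 ^+ 2 * stiffness w w.
Proof.
move=> c00 C0 cc hw; rewrite /normL2 /normL2v => h.
have m0 : 0 <= mass w w by apply: Rintegral_ge0 => x _; rewrite -expr2 sqr_ge0.
have g0 : 0 <= dotL2v Om (grad w) (grad w).
  by apply: Rintegral_ge0 => x _; apply: sumr_ge0 => i _; rewrite -expr2 sqr_ge0.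
have h1 : mass w w <= COm ^+ 2 * dotL2v Om (grad w) (grad w).
  rewrite -[mass w w]sqr_sqrtr// -[dotL2v _ _ _]sqr_sqrtr// -exprMn.
  by rewrite lerXn2r// nnegrE ?sqrtr_ge0// mulr_ge0 ?sqrtr_ge0// ltW.
apply: (le_trans h1); rewrite -mulrA ler_wpM2l ?sqr_ge0//.
rewrite mulrC ler_pdivlMr ?exprn_gt0// mulrC /dotL2v -RintegralZl//; last exact: grad_integrable.
apply: ae_le_Rintegral => //.
- by apply: RintegrableZ => //; exact: grad_integrable.
- exact: stiffness_integrable.
- apply: ae_impl cc => x h2 Ox; rewrite /dotr mulr_sumr; apply: ler_sum => i _.
  rewrite mxE -mulrA ler_wpM2r//; first by rewrite -expr2 sqr_ge0.
  by rewrite lerXn2r// ?nnegrE ?h2// ltW// (lt_le_trans c00)// h2.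
Qed.

End spatial_forms.

Section newton_potential.
Context {R : realType} {d : nat}.
Variables (Om : set 'rV[R]_d) (c : 'rV[R]_d -> R) (Sx : set (sobolev R d)) (K : R).
Notation mu := (lebesgue_rV d).
Hypothesis mOm : measurable Om.
Hypothesis cLinfty : Linfty mu Om c.
Hypothesis Sfin : fin_dim_subspace (ae_eq_sobolev Om) Sx.
Hypothesis SL2 : Sx `<=` L2_sobolev Om.
Hypothesis K0 : 0 < K.
Hypothesis poincare : forall u, Sx u -> mass Om u u <= K * stiffness Om c u u.

Local Notation m := (mass Om).
Local Notation a := (stiffness Om c).
Let N u := newton Om c Sx (value u).

(** The inner product of the norm [normN]: both arguments are represented by their Newton
    potentials. *)
Definition newton_form (u v : sobolev R d) : R :=
  stiffness Om c (newton Om c Sx (value u)) (newton Om c Sx (value v)).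

Lemma fin_dim_subspace_closed : subspace_closed Sx.
Proof. by case: Sfin. Qed.

Let hm : semi_inner Sx m. Proof. exact: mass_semi_inner. Qed.
Let ha : semi_inner Sx a. Proof. exact: stiffness_semi_inner. Qed.

Lemma newtonP u : Sx u -> Sx (N u) /\ forall v, Sx v -> a (N u) v = m u v.
Proof.
move=> Su; have [S0 Slin [n [b [Sb bspan]]]] := Sfin.
have [] := @galerkin_solvable _ _ Sx a m K n b fin_dim_subspace_closed ha hm poincare Sb _ u Su.
  move=> v Sv; have [al hal] := bspan v Sv; exists al => z Sz.
  have Ssum : Sx (\sum_i al i *: b i) by exact: (subspace_closed_sum fin_dim_subspace_closed).
  split.
    rewrite (stiffness_ae mOm cLinfty _ _ _ hal); [|exact: SL2..].
    by rewrite (semi_inner_sumr fin_dim_subspace_closed ha).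
  rewrite (mass_ae mOm _ _ _ hal); [|exact: SL2..].
  by rewrite (semi_inner_sumr fin_dim_subspace_closed hm).
move=> w Sw hw; rewrite /N /newton.
have [] // := @xgetPex _ 0 [set w | Sx w /\ forall v, Sx v ->
    dotL2v Om (fun x => c x ^+ 2 *: grad w x) (grad v) = dotL2 Om (value u) (value v)].
by exists w.
Qed.

Lemma newton_in u : Sx u -> Sx (newton Om c Sx (value u)).
Proof. by case/newtonP. Qed.

Lemma stiffness_newton u v : Sx u -> Sx v ->
  stiffness Om c (newton Om c Sx (value u)) v = mass Om u v.
Proof. by move=> /newtonP[_]; exact. Qed.

(** One of the two potentials can be traded for a mass product, which makes the form
    linear although [newton] picks arbitrary representatives. *)
Lemma newton_formE u v : Sx u -> Sx v ->
  newton_form u v = mass Om u (newton Om c Sx (value v)).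
Proof. by move=> Su Sv; apply: stiffness_newton => //; exact: newton_in. Qed.

Lemma newton_form_semi_inner : semi_inner Sx newton_form.
Proof.
have nC u z : Sx u -> Sx z -> newton_form u z = newton_form z u.
  by move=> Su Sz; rewrite /newton_form (semi_innerC ha)//; exact: newton_in.
split => //.
- move=> al u v z Su Sv Sz; have [_ Slin] := fin_dim_subspace_closed.
  have Nz := newton_in Sz.
  by rewrite !newton_formE// ?(semi_inner_linl hm)//; exact: Slin.
- by move=> u Su; apply: (semi_inner_ge0 ha); exact: newton_in.
Qed.

(** Expand [0 <= m w w] for [w = u - N u / K] and use [m (N u) (N u) <= K n u u]. *)
Lemma newton_form_le u : Sx u -> newton_form u u <= K * mass Om u u.
Proof.
move=> Su; have NS := newton_in Su.
have n1 : newton_form u u = m u (N u) by exact: newton_formE.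
have n2 : m (N u) (N u) <= K * newton_form u u by exact: poincare.
have [_ Slin] := fin_dim_subspace_closed.
(* With this shift the bound on [m (N u) (N u)] absorbs half of the mixed term. *)
have Sw : Sx ((- K^-1) *: N u + u) by exact: Slin.
have := semi_inner_ge0 hm Sw.
rewrite (semi_inner_linl hm)// !(semi_inner_linr fin_dim_subspace_closed hm)//.
rewrite (semi_innerC hm NS Su) -n1.
move: (m (N u) (N u)) (m u u) (newton_form u u) n2 => x y z xz h.
have : K^-1 * x <= z by rewrite mulrC ler_pdivrMr// mulrC.
move=> h'.
have : 0 <= y - K^-1 * z.
  have h2 : K^-1 * (K^-1 * x) <= K^-1 * z by rewrite ler_wpM2l// invr_ge0 ltW.
  by move: h h2; move: (K^-1) => i h h2; lra.
by rewrite subr_ge0 mulrC ler_pdivrMr// mulrC.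
Qed.

Lemma newton_form_eq0 u : Sx u -> newton_form u u = 0 -> mass Om u u = 0.
Proof.
move=> Su n0; have NS := newton_in Su.
rewrite -(stiffness_newton Su Su) (semi_innerC ha)//.
exact: (semi_inner_null fin_dim_subspace_closed ha).
Qed.

End newton_potential.

(** * Coercivity on the test pair *)

Section inf_sup.
Context {R : realType} {F : lmodType R}.
Variables (W : set F) (m a n : F -> F -> R) (K T : R) (A B C D P : F).
Hypotheses (hW : subspace_closed W) (hm : semi_inner W m) (ha : semi_inner W a)
  (hn : semi_inner W n).
Hypotheses (WA : W A) (WB : W B) (WC : W C) (WD : W D) (WP : W P).
Hypotheses (mDP : m D P = n D D) (aPP : a P P = n D D) (nDB : n D B = m B P)
  (eA : a A A <= 2 * T * a A B) (eC : m C C <= 2 * T * m C D)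
  (mPP : m P P <= K * n D D) (nBB : n B B <= K * m B B).
Let lam := (2 * T) *: B + P.
Let chi := (2 * T) *: D + (-1) *: B.

Let Wlam : W lam. Proof. by case: hW => _; exact. Qed.
Let WN : W ((-1) *: B).
Proof. by case: hW => W0 Wlin; rewrite -[_ *: _]addr0; exact: Wlin. Qed.
Let Wchi : W chi. Proof. by case: hW => _; exact. Qed.

Let linr b z s u v : semi_inner W b -> W u -> W v -> W z ->
  b z (s *: u + v) = s * b z u + b z v.
Proof. by move=> hb; exact: (semi_inner_linr hW hb). Qed.

Let linl b z s u v : semi_inner W b -> W u -> W v -> W z ->
  b (s *: u + v) z = s * b u z + b v z.
Proof. by move=> hb; exact: (semi_inner_linl hb). Qed.

Let scaler b z s u : semi_inner W b -> W u -> W z -> b z (s *: u) = s * b z u.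
Proof.
move=> hb Wu Wz; have [W0 _] := hW; rewrite -[s *: u]addr0 linr//.
by rewrite (semi_innerC hb Wz W0) (semi_inner0l hW hb Wz) addr0.
Qed.

Let scalel b z s u : semi_inner W b -> W u -> W z -> b (s *: u) z = s * b u z.
Proof.
move=> hb Wu Wz; have Ws : W (s *: u).
  by case: hW => W0 Wlin; rewrite -[_ *: _]addr0; exact: Wlin.
by rewrite (semi_innerC hb Ws Wz) scaler// (semi_innerC hb Wz Wu).
Qed.

(** Here [A, B] stand for [U] and its time derivative, [C, D] for [V] and its time
    derivative, and [P] for the Newton potential of [D]. *)
Lemma inf_sup_coercive :
  (m B B + n D D + a A A + m C C) / 2 <= m D lam + a A lam - m B chi + m C chi.
Proof.
have h1 : 0 <= a A A + 2 * a A P + a P P.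
  have := semi_inner_ge0 ha (proj2 hW 1 A P WA WP).
  by rewrite linl// ?linr// ?(semi_innerC ha WP WA); [lra|case: hW => _; exact].
have h2 : 0 <= m C C - 2 * m C B + m B B.
  have := semi_inner_ge0 hm (proj2 hW (-1) B C WB WC).
  by rewrite linl// ?linr// ?(semi_innerC hm WB WC); [lra|case: hW => _; exact].
rewrite /lam /chi !linr// !scaler// mDP (semi_innerC hm WD WB).
rewrite aPP in h1; move: eA eC h1 h2.
move: (a A A) (a A B) (m C C) (m C D) (m B B) (n D D) (a A P) (m C B) (m B D) => *.
lra.
Qed.

(** The mixed terms cancel: [4 T m B P] against [- 4 T n D B]. *)
Lemma inf_sup_test_norm : m lam lam + n chi chi =
  4 * T ^+ 2 * (m B B + n D D) + m P P + n B B.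
Proof.
rewrite /lam /chi !linl// !linr// !scalel// !scaler//.
by rewrite (semi_innerC hm WP WB) (semi_innerC hn WB WD) nDB; ring.
Qed.

Lemma inf_sup_test_bound :
  m lam lam + n chi chi <= (K + 4 * T ^+ 2) * (m B B + n D D).
Proof.
rewrite inf_sup_test_norm -addrA [leRHS]mulrDl addrC lerD2r mulrDr addrC.
exact: lerD.
Qed.

End inf_sup.

Lemma inf_sup_quotient {R : realType} (X Y G A : R) :
  0 < X -> 0 < Y -> 0 < G -> Y <= G * X -> X / 2 <= A ->
  1 / (2 * Num.sqrt G) <= A / (Num.sqrt X * Num.sqrt Y).
Proof.
move=> X0 Y0 G0 YX XA.
have sX : 0 < Num.sqrt X by rewrite sqrtr_gt0.
have sY : 0 < Num.sqrt Y by rewrite sqrtr_gt0.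
have sG : 0 < Num.sqrt G by rewrite sqrtr_gt0.
rewrite ler_pdivlMr ?mulr_gt0// mulrAC ler_pdivrMr ?mulr_gt0// mul1r.
have h : Num.sqrt Y <= Num.sqrt G * Num.sqrt X.
  by rewrite -sqrtrM; [exact: ler_wsqrtr|exact: ltW].
apply: (@le_trans _ _ (Num.sqrt X * (Num.sqrt G * Num.sqrt X))); first by rewrite ler_wpM2l// ltW.
rewrite mulrCA -expr2 sqr_sqrtr; last exact: ltW.
by rewrite mulrC mulrA ler_pM2r// -ler_pdivrMr.
Qed.

Section weighted_norms.
Context {R : realType} {d : nat}.
Variables (Om : set 'rV[R]_d) (T : R) (c : 'rV[R]_d -> R) (Sx : set (sobolev R d)).

Lemma weighted_int_ge0 (h : R -> R) : (forall t, 0 <= h t) -> 0 <= weighted_int T h.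
Proof. by move=> h0; apply: Rintegral_ge0 => t _; rewrite mulr_ge0// expR_ge0. Qed.

Lemma sqr_norme (L : R -> sobolev R d) :
  norme Om T (values L) ^+ 2 = wform T (mass Om) L L.
Proof.
rewrite sqr_sqrtr//; apply: weighted_int_ge0 => t.
by apply: Rintegral_ge0 => x _; rewrite -expr2 sqr_ge0.
Qed.

Lemma sqr_normev (L : R -> sobolev R d) :
  normev Om T (fun t x => c x *: gradients L t x) ^+ 2 = wform T (stiffness Om c) L L.
Proof.
rewrite sqr_sqrtr; last first.
  apply: weighted_int_ge0 => t; apply: Rintegral_ge0 => x _.
  by apply: sumr_ge0 => i _; rewrite -expr2 sqr_ge0.
congr weighted_int; apply/funext => t; apply: eq_Rintegral => x _.
by apply: eq_bigr => i _; rewrite !mxE /gradients; ring.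
Qed.

Lemma sqr_normN (L : R -> sobolev R d) :
  normN Om T c Sx (values L) ^+ 2 = wform T (newton_form Om c Sx) L L.
Proof. exact: (sqr_normev (fun t => newton Om c Sx (value (L t)))). Qed.

End weighted_norms.

Unset Implicit Arguments.

Theorem proposition4p2 (R : realType) (d : nat) (Om : set 'rV[R]_d)
    (T c0 COm : R) (c : 'rV[R]_d -> R)
    (Sx : set (sobolev R d)) (St : set (sobolev_time R)) :
  (1 <= d <= 3)%N -> lipschitz_polytopal_domain Om -> 0 < T ->
  Linfty (lebesgue_rV d) Om c -> 0 < c0 ->
  {ae lebesgue_rV d, forall x, Om x -> c0 <= c x} ->
  0 < COm ->
  (forall w, H10 Om w -> normL2 Om (value w) <= COm * normL2v Om (grad w)) ->
  fin_dim_subspace (ae_eq_sobolev Om) Sx -> Sx `<=` H10 Om ->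
  fin_dim_subspace (ae_eq_time T) St -> St `<=` H10_time T ->
  forall U V : (R -> sobolev R d) * (R -> sobolev R d),
    Qh Sx St U -> Qh Sx St V ->
    ~ (zero_on_QT Om T U.1 /\ zero_on_QT Om T V.1) ->
  exists lam chi : R -> sobolev R d,
    [/\ dQh Sx St lam, dQh Sx St chi,
        ~ (zero_on_QT Om T lam /\ zero_on_QT Om T chi) &
        1 / (2 * Num.sqrt (COm ^+ 2 / c0 ^+ 2 + 4 * T ^+ 2)) <=
        blfA Om T c U V lam chi /
          (normV Om T c Sx U V * normW Om T c Sx lam chi)].
Proof.
move=> _ [[oOm _ _ _] _] T0 cL c00 cc C0 poinc Sfin SxH Stfin StH [A B] [C D] /=.
move=> [nU [w [p [Sw Sp /= AE BE]]]] [nV [z [q [Sz Sq /= CE DE]]]] nonzero.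
have mOm := open_measurable_rV oOm.
have SL2 : Sx `<=` L2_sobolev Om by move=> u /SxH[[hu hg _] _].
pose K := COm ^+ 2 / c0 ^+ 2.
have K0 : 0 < K by rewrite divr_gt0// exprn_gt0.
have pK u : Sx u -> mass Om u u <= K * stiffness Om c u u.
  move=> Su; apply: (poincare_mass_stiffness mOm cL c00 C0 cc); first exact: SL2.
  by apply: poinc; exact: SxH.
have hS : subspace_closed Sx := fin_dim_subspace_closed Sfin.
have hm : semi_inner Sx (mass Om) by exact: mass_semi_inner.
have ha : semi_inner Sx (stiffness Om c) by exact: stiffness_semi_inner.
have hn : semi_inner Sx (newton_form Om c Sx).
  exact: (newton_form_semi_inner mOm cL Sfin SL2 pK).
have NS := newton_in mOm cL Sfin SL2 pK.
have aN := stiffness_newton mOm cL Sfin SL2 pK.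
have nE := newton_formE mOm cL Sfin SL2 pK.
have nle := newton_form_le mOm cL Sfin SL2 K0 pK.
have n0 := newton_form_eq0 mOm cL Sfin SL2 pK.
pose P : R -> sobolev R d := fun t => \sum_i (q i).2 t *: newton Om c Sx (value (z i)).
pose W := tensor_evol Sx (L2 (@lebesgue_measure R) `]0, T[).
have hW : subspace_closed W by exact: tensor_evol_closed.
have hd : subspace_closed (dQh Sx St) by exact: tensor_evol_closed.
have dW : dQh Sx St `<=` W.
  move=> L [j [v [r [Sv Sr ->]]]]; exists j, v, r; split => // i.
  by have [s Ss <-] := Sr i; have [[_ ? _] _] := StH _ Ss.
have dB : dQh Sx St B.
  by exists nU, w, (fun i => (p i).2); split => // i; exists (p i).
have dD : dQh Sx St D.
  by exists nV, z, (fun i => (q i).2); split => // i; exists (q i).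
have dP : dQh Sx St P.
  exists nV, (fun i => newton Om c Sx (value (z i))), (fun i => (q i).2).
  by split => // i; [exact: NS|exists (q i)].
have WA : W A.
  by exists nU, w, (fun i => (p i).1); split => // i; have [[]] := StH _ (Sp i).
have WC : W C.
  by exists nV, z, (fun i => (q i).1); split => // i; have [[]] := StH _ (Sq i).
have WB := dW _ dB; have WD := dW _ dD; have WP := dW _ dP.
have SB t : Sx (B t) := tensor_evol_in t hS WB.
have SD t : Sx (D t) := tensor_evol_in t hS WD.
have SP t : Sx (P t) := tensor_evol_in t hS WP.
have aP t v : Sx v -> stiffness Om c (P t) v = mass Om (D t) v.
  move=> Sv; rewrite DE (semi_inner_suml hS ha)//; last by move=> i; exact: NS.
  by rewrite (semi_inner_suml hS hm)//; apply: eq_bigr => i _; rewrite aN.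
pose wm := wform T (mass Om); pose wa := wform T (stiffness Om c).
pose wn := wform T (newton_form Om c Sx).
have hwm : semi_inner W wm by exact: wform_semi_inner.
have hwa : semi_inner W wa by exact: wform_semi_inner.
have hwn : semi_inner W wn by exact: wform_semi_inner.
(* [P t] and [newton (value (D t))] may be different functions, but the form [a] does
   not distinguish them on [Sx]. *)
have swap t v : Sx v -> newton_form Om c Sx (D t) v = mass Om v (P t).
  move=> Sv; rewrite (nE _ _ (SD t) Sv) -(aP t _ (NS _ Sv)).
  by rewrite (semi_innerC ha (SP t) (NS _ Sv)) (aN _ _ Sv (SP t)).
have aPP : wa P P = wn D D.
  congr weighted_int; apply/funext => t.
  by rewrite (swap t _ (SD t)) (aP t _ (SP t)).
have mDP : wm D P = wn D D.
  by congr weighted_int; apply/funext => t; rewrite (swap t _ (SD t)).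
have nDB : wn D B = wm B P.
  by congr weighted_int; apply/funext => t; rewrite (swap t _ (SB t)).
have eA : wa A A <= 2 * T * wa A B.
  by rewrite /wa AE BE; apply: (wform_energy T0 hS ha Sw) => i; exact: StH.
have eC : wm C C <= 2 * T * wm C D.
  by rewrite /wm CE DE; apply: (wform_energy T0 hS hm Sz) => i; exact: StH.
have mPP : wm P P <= K * wn D D by rewrite -aPP; exact: (wform_le T0 hS hm ha).
have nBB : wn B B <= K * wm B B by exact: (wform_le T0 hS hn hm).
pose lam := (2 * T) *: B + P; pose chi := (2 * T) *: D + (-1) *: B.
have dlam : dQh Sx St lam by exact: (proj2 hd _ _ _ dB dP).
have dchi : dQh Sx St chi.
  have dNB := proj2 hd (-1) _ _ dB (proj1 hd); rewrite addr0 in dNB.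
  exact: (proj2 hd _ _ _ dD dNB).
have coercive := inf_sup_coercive hW hwm hwa WA WB WC WD WP mDP aPP eA eC.
have testE := inf_sup_test_norm T hW hwm hwn WB WD WP nDB.
have test_le := inf_sup_test_bound T hW hwm hwn WB WD WP nDB mPP nBB.
rewrite -/lam -/chi in coercive testE test_le.
have wmE : wm = wform T (mass Om) := erefl.
have wnE : wn = wform T (newton_form Om c Sx) := erefl.
have waE : wa = wform T (stiffness Om c) := erefl.
(* From here on only the bilinear structure matters until the norms are unfolded. *)
clearbody wm wn wa.
have B0 : 0 <= wm B B by exact: (semi_inner_ge0 hwm).
have D0 : 0 <= wn D D by exact: (semi_inner_ge0 hwn).
have A0 : 0 <= wa A A by exact: (semi_inner_ge0 hwa).
have CC0 : 0 <= wm C C by exact: (semi_inner_ge0 hwm).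
(* If both time derivatives had zero norm, the energy inequality would force [U] and [V]
   to vanish. *)
have BD0 : 0 < wm B B + wn D D.
  rewrite lt_neqAle (addr_ge0 B0 D0) andbT; apply/negP => /eqP BD.
  have Bz : wm B B = 0 by apply/eqP; rewrite eq_le B0 andbT BD lerDl.
  have Dz : wn D D = 0 by apply/eqP; rewrite eq_le D0 andbT BD lerDr.
  apply: nonzero; split.
    have AA : wm A A = 0.
      apply/eqP; rewrite eq_le (semi_inner_ge0 hwm WA) andbT.
      have : wm A A <= 2 * T * wm A B.
        by rewrite wmE AE BE; apply: (wform_energy T0 hS hm Sw) => i; exact: StH.
      by rewrite (semi_inner_null hW hwm WA WB Bz) mulr0.
    rewrite wmE in AA.
    have := wform_eq0_ae T0 hS hm WA AA; apply: ae_impl => t h It.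
    by apply: (mass_eq0_ae mOm); [exact/SL2/(tensor_evol_in t hS WA)|exact: h].
  have CC : wn C C = 0.
    apply/eqP; rewrite eq_le (semi_inner_ge0 hwn WC) andbT.
    have : wn C C <= 2 * T * wn C D.
      by rewrite wnE CE DE; apply: (wform_energy T0 hS hn Sz) => i; exact: StH.
    by rewrite (semi_inner_null hW hwn WC WD Dz) mulr0.
  rewrite wnE in CC.
  have := wform_eq0_ae T0 hS hn WC CC; apply: ae_impl => t h It.
  have SC := tensor_evol_in t hS WC.
  by apply: (mass_eq0_ae mOm); [exact: SL2|apply: n0; [exact: SC|exact: h]].
have Y0 : 0 < wm lam lam + wn chi chi.
  have T20 : 0 < 4 * T ^+ 2 by rewrite mulr_gt0// exprn_gt0.
  rewrite testE ltr_wpDr ?(semi_inner_ge0 hwn WB)//.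
  by rewrite ltr_wpDr ?(semi_inner_ge0 hwm WP)// mulr_gt0.
exists lam, chi; split => //.
  move=> [lam0 chi0].
  (* A pair that vanishes on the cylinder has zero norm, as [n] is dominated by [m]. *)
  have massz L : dQh Sx St L -> zero_on_QT Om T L -> wm L L = 0.
    move=> dL Lz; rewrite wmE; apply: (ae_wform_eq0 T0 hS hm) (dW _ dL).
    apply: ae_impl Lz => t h It; apply: (ae_mass_eq0 mOm).
      exact/SL2/(tensor_evol_in t hS (dW _ dL)).
    exact: h.
  have lz := massz _ dlam lam0; have cz := massz _ dchi chi0.
  have : wn chi chi <= K * wm chi chi.
    by rewrite wnE wmE; apply: (wform_le T0 hS hn hm nle); exact: dW.
  by rewrite cz mulr0 leNgt; move: Y0; rewrite lz add0r => ->.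
have -> : blfA Om T c (A, B) (C, D) lam chi = wm D lam + wa A lam - wm B chi + wm C chi.
  by rewrite wmE waE.
have -> : normV Om T c Sx (A, B) (C, D) = Num.sqrt (wm B B + wn D D + wa A A + wm C C).
  congr (Num.sqrt (_ + _ + _ + _)).
  - by rewrite wmE; exact: sqr_norme.
  - by rewrite wnE; exact: sqr_normN.
  - by rewrite waE; exact: sqr_normev.
  - by rewrite wmE; exact: sqr_norme.
have -> : normW Om T c Sx lam chi = Num.sqrt (wm lam lam + wn chi chi).
  congr (Num.sqrt (_ + _)); first by rewrite wmE; exact: sqr_norme.
  by rewrite wnE; exact: sqr_normN.
have T20 : 0 < 4 * T ^+ 2 by rewrite mulr_gt0// exprn_gt0.
have le0 : wm B B + wn D D <= wm B B + wn D D + wa A A + wm C C.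
  by rewrite -addrA lerDl addr_ge0.
apply: inf_sup_quotient => //.
- exact: lt_le_trans BD0 le0.
- exact: addr_gt0.
- by apply: (le_trans test_le); rewrite ler_wpM2l// ltW// addr_gt0.
Qed.
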